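(* Fix $0<q<1$ and $\sigma>0$. Consider a sequence of problems with orthogonal designs $X$ (that is, $X'X=I_p$) in which $p\to\infty$ and the integers $k=k_p\ge 1$ satisfy $k/p\to 0$. Then the SLOPE estimate $\hat\beta_{\mathrm{SLOPE}}$ with weights $\lambda_i=\sigma\cdot\Phi^{-1}(1-iq/(2p))$, $1\le i\le p$, obeys $$\sup_{\|\beta\|_0\le k}\mathbb{E}\,\|\hat\beta_{\mathrm{SLOPE}}-\beta\|^2=(1+o(1))\,2\sigma^2k\log(p/k).$$
   Context: We observe $y=X\beta+z$, where $X\in\mathbb{R}^{n\times p}$ is the design matrix, $\beta\in\mathbb{R}^p$ is unknown and $z\sim\mathcal{N}(0,\sigma^2I_n)$. $\|\beta\|_0$ is the number of nonzero entries of $\beta$, $\|\cdot\|$ is the Euclidean norm, and $\Phi$ is the standard normal cumulative distribution function. Given weights $\lambda_1\ge\lambda_2\ge\cdots\ge\lambda_p\ge0$, not all zero, the SLOPE estimate is the solution (minimizer) $\hat\beta_{\mathrm{SLOPE}}$ of $$\min_{b\in\mathbb{R}^p}\ \tfrac12\|y-Xb\|^2+\lambda_1|b|_{(1)}+\cdots+\lambda_p|b|_{(p)},$$ where $|b|_{(1)}\ge\cdots\ge|b|_{(p)}$ are the order statistics of $|b_1|,\dots,|b_p|$. The supremum is over all $\beta\in\mathbb{R}^p$ with at most $k$ nonzero entries. *)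

(* Defs.v *)
From HB Require Import structures.
From mathcomp Require Import all_boot all_order all_algebra.
From mathcomp Require Import all_classical all_reals all_analysis.

Set Implicit Arguments.
Unset Strict Implicit.
Unset Printing Implicit Defensive.

Import Order.TTheory GRing.Theory Num.Theory.
Import numFieldNormedType.Exports.

Local Open Scope classical_set_scope.
Local Open Scope ring_scope.

(* The library norm `|v| of a matrix is the sup norm, hence this definition. *)
Definition norm2 (R : realType) (n : nat) (v : 'cV[R]_n) : R :=
  Num.sqrt (\sum_i v i 0 ^+ 2).

Definition norm0 (R : realType) (p : nat) (b : 'cV[R]_p) : nat :=
  #|[pred i | b i 0 != 0]|.

(* |b|_(i), with i counted from 1 and |b|_(1) the largest. *)
Definition abs_order_stat (R : realType) (p : nat) (b : 'cV[R]_p) (i : nat) : R :=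
  nth 0 (sort (fun x y : R => y <= x) [seq `|b j 0| | j <- enum 'I_p]) i.-1.

Definition slope_objective (R : realType) (n p : nat) (X : 'M[R]_(n, p))
    (lambda : nat -> R) (y : 'cV[R]_n) (b : 'cV[R]_p) : R :=
  2^-1 * norm2 (y - X *m b) ^+ 2
  + \sum_(1 <= i < p.+1) lambda i * abs_order_stat b i.

Definition is_slope_estimator (R : realType) (n p : nat) (X : 'M[R]_(n, p))
    (lambda : nat -> R) (betahat : 'cV[R]_n -> 'cV[R]_p) : Prop :=
  forall (y : 'cV[R]_n) (b : 'cV[R]_p),
    slope_objective X lambda y (betahat y) <= slope_objective X lambda y b.

Definition Phi (R : realType) (x : R) : R :=
  fine (normal_prob (0 : R) 1 `]-oo, x]).

(* Phi is a bijection onto ]0, 1[; elsewhere Phi_inv takes the junk value 0. *)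
Definition Phi_inv (R : realType) : R -> R := 'pinv_(fun=> 0) setT (@Phi R).

Definition slope_weight (R : realType) (q sigma : R) (p i : nat) : R :=
  sigma * Phi_inv (1 - i%:R * q / (2 * p%:R)).

Definition mutually_independent (R : realType) (d : measure_display)
    (T : measurableType d) (P : probability T R) (n : nat)
    (z : 'I_n -> {RV P >-> R}) : Prop :=
  forall (J : {set 'I_n}) (A : 'I_n -> set R),
    (forall i, measurable (A i)) ->
    P (\bigcap_(i in [set` J]) (z i @^-1` A i))
    = (\prod_(i in J) P (z i @^-1` A i))%E.

(* z ~ N(0, sigma^2 I_n); the second parameter of normal_prob is the standard
   deviation. *)
Definition gaussian_noise (R : realType) (d : measure_display)
    (T : measurableType d) (P : probability T R) (n : nat) (sigma : R)
    (z : 'I_n -> {RV P >-> R}) : Prop :=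
  (forall i (A : set R), measurable A ->
     distribution P (z i) A = normal_prob 0 sigma A)
  /\ mutually_independent z.

Definition observation (R : realType) (d : measure_display)
    (T : measurableType d) (P : probability T R) (n p : nat)
    (X : 'M[R]_(n, p)) (beta : 'cV[R]_p) (z : 'I_n -> {RV P >-> R}) (w : T) :
    'cV[R]_n :=
  X *m beta + \col_i z i w.

Definition risk (R : realType) (d : measure_display)
    (T : measurableType d) (P : probability T R) (n p : nat)
    (X : 'M[R]_(n, p)) (z : 'I_n -> {RV P >-> R})
    (betahat : 'cV[R]_n -> 'cV[R]_p) (beta : 'cV[R]_p) : \bar R :=
  'E_P[fun w => norm2 (betahat (observation X beta z w) - beta) ^+ 2].

(* Main.v *)
Require Import Defs.
From HB Require Import structures.
From mathcomp Require Import all_boot all_order all_algebra.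
From mathcomp Require Import all_classical all_reals all_analysis.
From mathcomp Require Import measurable_realfun perm ring lra.
Import Order.TTheory GRing.Theory Num.Theory.
Import numFieldNormedType.Exports.
Local Open Scope classical_set_scope.
Local Open Scope ring_scope.
Set Implicit Arguments.
Unset Strict Implicit.
Unset Printing Implicit Defensive.

(** Write J for the sorted l1 penalty, h for the error of the estimate and
    g = X'z for the noise seen through the design. As X'X = I, the SLOPE
    objective is |X'y - b|^2 / 2 + J(b) up to a constant, with
    X'y = beta + g, and the coordinates of g are pairwise independent normal
    variables. Convexity of J turns minimality of bh into a variational
    inequality, <X'y - bh, b - bh> <= J(b) - J(bh) for all b
    (slope_variational), and both halves of the theorem come from one choice
    of b in it.

    Upper bound. The choice b = beta and the inequality xy <= x^2/2 + y^2/2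
    give, for a set S of k indices that carries beta (slope_upper),
      |h|^2 <= (1 + d) sum_(i <= k) lambda_i^2 + (1 + 1/d) sum_(j in S) g_j^2
               + sum_(i <= p - k) max(0, |g|_(i) - lambda_(k+i))^2.
    The first sum is 2 sigma^2 k log(p/k) up to O(k), because the two-sided
    normal tail at lambda_i / sigma is i q / p (sum_weight_sqr_ub). The second
    is O(k) in expectation. In the third, q < 1 makes lambda_(k+i) exceed the
    typical size of |g|_(i) once i >= C k. The ranks below C k contribute O(k).
    For a larger rank, |g|_(i) > lambda_(k+i) means that a sum of pairwise
    independent terms is far above its mean, and the Chebyshev inequality
    bounds the expected square by A / (i lambda_(k+i)^2) in units of sigma
    (ostat_crossing, variance_sum_le, rank_bound_integral). These bounds add up
    to o(log(p/k)): for any constant M there is eps > 0 such that the weights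
    exceed M sigma on all ranks i <= eps p, while the harmonic sum over the
    remaining ranks is bounded (rank_sum_ub).

    Lower bound. Let beta have k equal and huge entries. Moving these k
    coordinates of bh toward 0 by a common amount a lowers J by
    a (lambda_1 + ... + lambda_k), so the estimate is biased downwards by the
    mean of these weights, and the squared bias is at least
    k lambda_k^2 ~ 2 sigma^2 k log(p/k) (slope_lower, last_weight_lb).

    Pairwise independence of g is obtained by plane rotations: a rotation of
    two coordinates preserves independent standard normal families
    (iid_gauss_rotate), and finitely many of them carry two orthonormal linear
    forms to two distinct coordinates (gauss_concentrate, gauss_lin2).

    All estimates are quantitative (slope_max_risk_bounds): the relative error
    is at most del as soon as log(p/k) exceeds a number that depends on q and
    del only. *)

(** * Order statistics and the sorted l1 penalty *)

Section slope_penalty.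
Context {R : realType}.

(** Ranks start at 0 here, so that they can index big sums over [0, p[. *)
Definition ostat (p : nat) (b : 'cV[R]_p) (i : nat) : R := abs_order_stat b i.+1.

Definition sorts (p : nat) (b : 'cV[R]_p) (s : {perm 'I_p}) : Prop :=
  (forall i : 'I_p, ostat b i = `|b (s i) 0|).

Lemma ostat_perm (p : nat) (b : 'cV[R]_p) : exists s : {perm 'I_p}, sorts b s.
Proof.
pose l := [seq `|b j 0| | j <- enum 'I_p].
have szl : size l = p by rewrite size_map size_enum_ord.
have szs : size (sort (fun x y : R => y <= x) l) == p by rewrite size_sort szl.
have szl' : size l == p by rewrite szl.
have /tuple_permP[s hs] : perm_eq (Tuple szs) (Tuple szl').
  by rewrite /= perm_sort.
exists s => i; rewrite /ostat /abs_order_stat -/l /=.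
have -> : sort (fun x y : R => y <= x) l = [seq tnth (Tuple szl') (s j) | j <- enum 'I_p].
  exact: hs.
rewrite (nth_map i) ?size_enum_ord// nth_ord_enum (tnth_nth 0) /= /l.
by rewrite (nth_map i) ?size_enum_ord// nth_ord_enum.
Qed.

Lemma ostat_ge0 (p : nat) (b : 'cV[R]_p) i : 0 <= ostat b i.
Proof.
rewrite /ostat /abs_order_stat /=; set l := sort _ _.
have [ip|ip] := ltnP i (size l); last by rewrite nth_default.
have /allP : all (fun x : R => 0 <= x) l.
  by rewrite all_sort; apply/allP => x /mapP[j _ ->].
by apply; exact: mem_nth.
Qed.

Lemma ostat_mono (p : nat) (b : 'cV[R]_p) i j : (i <= j)%N -> ostat b j <= ostat b i.
Proof.
move=> ij; have [jp|jp] := ltnP j p; last first.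
  rewrite {1}/ostat /abs_order_stat nth_default ?ostat_ge0//.
  by rewrite size_sort size_map size_enum_ord.
rewrite /ostat /abs_order_stat /=.
apply: (@sorted_leq_nth _ (fun x y : R => y <= x)) => //.
- by move=> y x z /= xy yz; exact: le_trans yz xy.
- exact: (sort_sorted (fun x y => le_total y x)).
- by rewrite inE size_sort size_map size_enum_ord (leq_ltn_trans ij).
- by rewrite inE size_sort size_map size_enum_ord.
Qed.

Lemma ostat_sum (p : nat) (b : 'cV[R]_p) (s : {perm 'I_p}) (F : R -> R) : sorts b s ->
  \sum_(i < p) F (ostat b i) = \sum_j F `|b j 0|.
Proof.
move=> sb; rewrite [RHS](reindex_inj (@perm_inj _ s)) /=.
by apply: eq_bigr => i _; rewrite sb.
Qed.

Lemma ostat_default (p : nat) (b : 'cV[R]_p) i : (p <= i)%N -> ostat b i = 0.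
Proof.
move=> pi; rewrite /ostat /abs_order_stat nth_default//.
by rewrite size_sort size_map size_enum_ord.
Qed.

(** Compare with the threshold t = ostat b m.-1 (where m is the size of A): the
    positive parts of |b_j| - t sum up, over all j, to exactly the sum of the
    first m values ostat b i - t. *)
Lemma top_sum (p : nat) (b : 'cV[R]_p) (A : {set 'I_p}) (m : nat) : (#|A| <= m)%N ->
  \sum_(j in A) `|b j 0| <= \sum_(0 <= i < m) ostat b i.
Proof.
move=> Am; have [s sb] := ostat_perm b.
wlog Am' : m {Am} / #|A| = m => [H|].
  apply: (le_trans (H _ erefl)).
  by rewrite [leRHS](big_cat_nat (n := #|A|))//= lerDl sumr_ge0// => i _; exact: ostat_ge0.
case: m Am' => [|m] Am.
  by rewrite big_geq// big1// => j jA; move/cards0_eq : Am jA => ->; rewrite inE.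
have mp : (m.+1 <= p)%N by rewrite -Am -[leqRHS]card_ord max_card.
pose t := ostat b m; pose pos (x : R) := Num.max 0 (x - t).
have H1 : \sum_(j in A) (`|b j 0| - t) <= \sum_j pos `|b j 0|.
  rewrite [leRHS](bigID (mem A)) /= -[leLHS]addr0 lerD//.
    by apply: ler_sum => j _; rewrite /pos le_max lexx orbT.
  by rewrite sumr_ge0// => j _; rewrite /pos le_max lexx.
have H2 : \sum_j pos `|b j 0| = \sum_(0 <= i < m.+1) (ostat b i - t).
  rewrite -(ostat_sum pos sb) -(big_mkord predT (fun i => pos (ostat b i))).
  have Z : \sum_(m.+1 <= i < p) pos (ostat b i) = 0.
    rewrite big_nat_cond big1// => i /andP[/andP[mi _] _].
    by rewrite /pos max_l// subr_le0; apply: ostat_mono; exact: ltnW.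
  rewrite [LHS](big_cat_nat (n := m.+1))//= Z addr0.
  apply: eq_big_nat => i /andP[_ im]; rewrite /pos max_r// subr_ge0.
  exact: ostat_mono.
move: H1; rewrite H2 !sumrB sumr_const Am big_const_nat subn0 iter_addr_0.
by rewrite lerD2r.
Qed.

Lemma top_sum_ord (p : nat) (b : 'cV[R]_p) (f : 'I_p -> 'I_p) (m : nat) :
  (m <= p)%N -> injective f ->
  \sum_(i < p | (i < m)%N) `|b (f i) 0| <= \sum_(0 <= i < m) ostat b i.
Proof.
move=> mp fi.
rewrite (_ : \sum_(i < p | (i < m)%N) `|b (f i) 0| =
  \sum_(j in f @: [set i : 'I_p | (i < m)%N]%SET) `|b j 0|).
  apply: top_sum; rewrite card_imset// -sum1_card.
  rewrite (eq_bigl (fun i : 'I_p => (i < m)%N)); last by move=> i; rewrite inE.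
  by rewrite (big_ord_narrow mp) sum1_card card_ord.
rewrite big_imset /=; last by move=> i j _ _ /fi.
by apply: eq_bigl => i; rewrite inE.
Qed.

(** Abel summation: the weighted sum dominates the last weight times the
    corresponding partial sum. *)
Lemma abel_ge0 (c d : nat -> R) (n : nat) :
  (forall i, (i < n)%N -> 0 <= c i) ->
  (forall i, (i.+1 < n)%N -> c i.+1 <= c i) ->
  (forall m, (m <= n)%N -> 0 <= \sum_(0 <= i < m) d i) ->
  0 <= \sum_(0 <= i < n) c i * d i.
Proof.
case: n => [|n] c0 cm d0; first by rewrite big_geq.
suff H : forall m, (m <= n)%N ->
    c m * \sum_(0 <= i < m.+1) d i <= \sum_(0 <= i < m.+1) c i * d i.
  by apply: le_trans (H n _) => //; rewrite mulr_ge0// ?c0// d0.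
elim=> [|m IH] mn; first by rewrite !big_nat1.
rewrite big_nat_recr//= [leRHS]big_nat_recr//= mulrDr lerD2r.
apply: le_trans (IH (ltnW mn)); rewrite ler_wpM2r//; last exact: cm.
by apply: d0; rewrite ltnS ltnW.
Qed.

(** The form in which rearrangement inequalities are used below: domination of
    partial sums is preserved by nonincreasing nonnegative weights. *)
Lemma abel_le (c u v : nat -> R) (n : nat) :
  (forall i, (i < n)%N -> 0 <= c i) ->
  (forall i, (i.+1 < n)%N -> c i.+1 <= c i) ->
  (forall m, (m <= n)%N -> \sum_(0 <= i < m) u i <= \sum_(0 <= i < m) v i) ->
  \sum_(0 <= i < n) c i * u i <= \sum_(0 <= i < n) c i * v i.
Proof.
move=> c0 cm uv; rewrite -subr_ge0 -sumrB.
under eq_bigr do rewrite -mulrBr.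
by apply: abel_ge0 => // m mn; rewrite sumrB subr_ge0 uv.
Qed.

Lemma ostat_eq0 (p : nat) (b : 'cV[R]_p) (A : {set 'I_p}) i :
  (forall j, j \notin A -> b j 0 = 0) -> (#|A| <= i)%N -> ostat b i = 0.
Proof.
move=> bA Ai; have [ip|/ostat_default->//] := ltnP i p.
have [s sb] := ostat_perm b.
apply/eqP; apply: contraLR Ai => nz; rewrite -ltnNge.
have -> : i.+1 = #|s @: [set j : 'I_p | (j < i.+1)%N]%SET|.
  rewrite card_imset; last exact: perm_inj.
  rewrite -sum1_card (eq_bigl (fun j : 'I_p => (j < i.+1)%N)); last by move=> j; rewrite inE.
  by rewrite (big_ord_narrow ip) sum1_card card_ord.
apply/subset_leq_card/fintype.subsetP => _ /imsetP[j + ->]; rewrite inE ltnS => ji.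
apply/negPn/negP => /bA bj0; move: nz; rewrite eq_le ostat_ge0 andbT => /negP; apply.
by rewrite (le_trans (ostat_mono b ji))// sb bj0 normr0.
Qed.

Definition penalty (p : nat) (lam : nat -> R) (b : 'cV[R]_p) : R :=
  \sum_(0 <= i < p) lam i * ostat b i.

Definition weights (p : nat) (lam : nat -> R) : Prop :=
  (forall i, (i < p)%N -> 0 <= lam i) /\
  (forall i, (i.+1 < p)%N -> lam i.+1 <= lam i).

Lemma penaltyE p lam (b : 'cV[R]_p) s : sorts b s ->
  penalty lam b = \sum_(i < p) lam i * `|b (s i) 0|.
Proof.
by move=> sb; rewrite /penalty big_mkord; apply: eq_bigr => i _; rewrite sb.
Qed.

(** Rearrangement inequality: the penalty is the maximum of these weighted sums
    over all orderings. This makes it convex. *)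
Lemma penalty_perm p lam (b : 'cV[R]_p) (s : {perm 'I_p}) : weights p lam ->
  \sum_(i < p) lam i * `|b (s i) 0| <= penalty lam b.
Proof.
move=> [l0 lm].
case: p b s l0 lm => [|p] b s l0 lm; first by rewrite big_ord0 /penalty big_geq.
pose u i := `|b (s (inord i)) 0|.
rewrite (_ : \sum_(i < p.+1) _ = \sum_(0 <= i < p.+1) lam i * u i).
  apply: abel_le => // m mp; apply: le_trans (top_sum_ord b mp (@perm_inj _ s)).
  rewrite big_mkord (big_ord_narrow mp) ler_sum// => i _.
  rewrite /u (_ : inord i = widen_ord mp i)//.
  by apply/val_inj; rewrite /= inordK// (leq_trans _ mp).
by rewrite big_mkord; apply: eq_bigr => i _; rewrite /u inord_val.
Qed.

Lemma penaltyD p lam (b c : 'cV[R]_p) : weights p lam ->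
  penalty lam (b + c) <= penalty lam b + penalty lam c.
Proof.
move=> lw; have [s sb] := ostat_perm (b + c).
rewrite (penaltyE lam sb); apply: le_trans (lerD (penalty_perm b s lw) (penalty_perm c s lw)).
rewrite -big_split/= ler_sum// => i _; rewrite -mulrDr ler_wpM2l ?(proj1 lw)//.
by rewrite mxE ler_normD.
Qed.

Lemma penaltyZ p lam (a : R) (b : 'cV[R]_p) : weights p lam -> 0 <= a ->
  penalty lam (a *: b) <= a * penalty lam b.
Proof.
move=> lw a0; have [s sb] := ostat_perm (a *: b).
rewrite (penaltyE lam sb); apply: le_trans (ler_wpM2l a0 (penalty_perm b s lw)).
rewrite mulr_sumr ler_sum// => i _.
by rewrite mxE normrM (ger0_norm a0) mulrCA.
Qed.

End slope_penalty.

(** * Pointwise bounds on the loss of a minimizer *)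

Section slope_upper_bound.
Context {R : realType}.

Definition dot (n : nat) (u v : 'cV[R]_n) : R := \sum_i u i 0 * v i 0.

Lemma norm2_sqr n (v : 'cV[R]_n) : norm2 v ^+ 2 = \sum_i v i 0 ^+ 2.
Proof. by rewrite /norm2 sqr_sqrtr// sumr_ge0// => i _; exact: sqr_ge0. Qed.

Lemma norm2_dot n (v : 'cV[R]_n) : norm2 v ^+ 2 = dot v v.
Proof. by rewrite norm2_sqr; apply: eq_bigr => i _; rewrite expr2. Qed.

Lemma dot_mx n (u v : 'cV[R]_n) : (u^T *m v) 0 0 = dot u v.
Proof. by rewrite mxE; apply: eq_bigr => i _; rewrite mxE. Qed.

Lemma dot_adj n p (X : 'M[R]_(n, p)) u w : dot w (X *m u) = dot (X^T *m w) u.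
Proof. by rewrite -!dot_mx trmx_mul trmxK mulmxA. Qed.

Lemma dotBZ n (u v : 'cV[R]_n) (t : R) :
  dot (u - t *: v) (u - t *: v) = dot u u - 2 * t * dot u v + t ^+ 2 * dot v v.
Proof.
rewrite /dot !mulr_sumr -sumrB -big_split/=; apply: eq_bigr => i _.
by rewrite !mxE; ring.
Qed.

(** Compare bh with the points bh + t (b - bh) of the segment to b, use convexity
    of the penalty, divide by t and let t tend to 0. The design disappears
    because it preserves dot products. *)
Lemma slope_variational n p (X : 'M[R]_(n, p)) lam y (bh : 'cV[R]_p) :
  X^T *m X = 1%:M -> weights p (fun i => lam i.+1) ->
  (forall b, slope_objective X lam y bh <= slope_objective X lam y b) ->
  forall b, dot (X^T *m y - bh) (b - bh) <=
     penalty (fun i => lam i.+1) b - penalty (fun i => lam i.+1) bh.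
Proof.
move=> XX lw opt b; set pen := penalty _.
set D := dot _ _; set v := b - bh.
have objE c : slope_objective X lam y c = 2^-1 * dot (y - X *m c) (y - X *m c) + pen c.
  rewrite /slope_objective norm2_dot; congr (_ + _).
  by rewrite /pen /penalty big_add1.
pose V := dot v v.
have V0 : 0 <= V by rewrite /V -norm2_dot sqr_ge0.
have key t : 0 < t -> t <= 1 -> D <= pen b - pen bh + t * V.
  move=> t0 t1; have := opt (bh + t *: v); rewrite !objE.
  rewrite mulmxDr opprD addrA -scalemxAr dotBZ.
  have -> : dot (X *m v) (X *m v) = V.
    by rewrite dot_adj mulmxA XX mul1mx.
  have -> : dot (y - X *m bh) (X *m v) = D.
    by rewrite dot_adj mulmxBr mulmxA XX mul1mx.
  have : pen (bh + t *: v) <= (1 - t) * pen bh + t * pen b.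
    have -> : bh + t *: v = (1 - t) *: bh + t *: b.
      by rewrite /v scalerBr scalerBl scale1r addrAC addrA.
    apply: le_trans (penaltyD _ _ lw) _.
    apply: lerD; apply: penaltyZ => //; [by rewrite subr_ge0|exact: ltW].
  move=> H1 H2; rewrite -(ler_pM2l t0); nra.
apply/ler_addgt0Pr => e e0.
pose t := Num.min 1 (e / (V + 1)).
have t0 : 0 < t by rewrite lt_min ltr01 divr_gt0// ltr_wpDl.
apply: le_trans (key t t0 _) _; first by rewrite ge_min lexx.
rewrite lerD2l; apply: (@le_trans _ _ (e / (V + 1) * (V + 1))).
  apply: ler_pM => //; first exact: ltW.
  - by rewrite ge_min lexx orbT.
  - by rewrite lerDl.
by rewrite divfK// gt_eqF// ltr_wpDl.
Qed.

Lemma sum_nat_split (k p : nat) (F G : nat -> R) : (k <= p)%N ->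
  \sum_(0 <= i < p) (if (i < k)%N then F i else G i) =
  \sum_(0 <= i < k) F i + \sum_(0 <= i < p - k) G (k + i)%N.
Proof.
move=> kp; rewrite (big_cat_nat (n := k))//=; congr (_ + _).
  by apply: eq_big_nat => i /andP[_ ->].
rewrite -{1}[k]add0n big_addn; apply: eq_big_nat => i _.
by rewrite ltnNge leq_addl addnC.
Qed.

Lemma sorts_sum_lt (p : nat) (b : 'cV[R]_p) s (m : nat) : sorts b s -> (m <= p)%N ->
  \sum_(0 <= i < m) ostat b i = \sum_(i < p | (i < m)%N) `|b (s i) 0|.
Proof.
move=> sb mp; rewrite big_mkord (big_ord_narrow mp); apply: eq_bigr => i _.
by rewrite -sb.
Qed.

(** The indices of the m largest magnitudes of b, when s sorts b. *)
Definition topset p (s : {perm 'I_p}) (m : nat) : {set 'I_p} :=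
  s @: [set i : 'I_p | (i < m)%N]%SET.

Lemma mem_topset p (s : {perm 'I_p}) m i : (s i \in topset s m) = (i < m)%N.
Proof. by rewrite mem_imset; [rewrite inE|exact: perm_inj]. Qed.

Lemma card_topset p (s : {perm 'I_p}) m : (m <= p)%N -> #|topset s m| = m.
Proof.
move=> mp; rewrite card_imset; last exact: perm_inj.
rewrite -sum1_card (eq_bigl (fun j : 'I_p => (j < m)%N)); last by move=> j; rewrite inE.
by rewrite (big_ord_narrow mp) sum1_card card_ord.
Qed.

Lemma sum_topset p (s : {perm 'I_p}) m (F : 'I_p -> R) :
  \sum_(j in topset s m) F j = \sum_(i < p | (i < m)%N) F (s i).
Proof.
rewrite big_imset /=; last by move=> i j _ _ /perm_inj.
by apply: eq_bigl => i; rewrite inE.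
Qed.

Lemma top_sum_topset p (b : 'cV[R]_p) s m : sorts b s -> (m <= p)%N ->
  \sum_(j in topset s m) `|b j 0| = \sum_(0 <= i < m) ostat b i.
Proof. by move=> sb mp; rewrite sum_topset (sorts_sum_lt sb mp). Qed.

(** The set S consists of the positions of the k largest entries of beta, so it
    depends on beta only and the noise on it has k coordinates whatever the
    value of g. Outside S the vector h coincides with the estimate: there the
    noise and the penalty are both compared with the sorted entries of h, the
    former by rearrangement, the latter by giving the weights of rank k and
    more to the complement of S. *)
Lemma slope_upper (p k : nat) (lam : nat -> R) (beta : 'cV[R]_p) (d : R) :
  (k <= p)%N -> weights p lam -> (norm0 beta <= k)%N -> 0 < d ->
  exists S : {set 'I_p}, #|S| = k /\ forall g bh : 'cV[R]_p,
    (forall b, dot (beta + g - bh) (b - bh) <= penalty lam b - penalty lam bh) ->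
    norm2 (bh - beta) ^+ 2 <=
      (1 + d) * \sum_(0 <= i < k) lam i ^+ 2 +
      (1 + d^-1) * \sum_(j in S) g j 0 ^+ 2 +
      \sum_(0 <= i < p - k) Num.max 0 (ostat g i - lam (k + i)%N) ^+ 2.
Proof.
move=> kp lw bk d0; have [s sb] := ostat_perm beta.
have [l0 lm] := lw.
pose S := topset s k; exists S; split; first exact: card_topset.
have betaS j : j \notin S -> beta j 0 = 0.
  rewrite -[j](permKV s) mem_topset -leqNgt => kj.
  apply/eqP; rewrite -normr_eq0 -sb; apply/eqP.
  apply: (@ostat_eq0 _ _ _ [set i | beta i 0 != 0]%SET) => [i|].
    by rewrite inE negbK => /eqP.
  by rewrite cardsE (leq_trans bk).
move=> g bh vi; pose h : 'cV[R]_p := bh - beta.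
(* h0 has at most p - k nonzero entries, so its order statistics vanish from
   rank p - k on. *)
pose h0 : 'cV[R]_p := \col_j (if j \in S then 0 else h j 0).
have [s0 sb0] := ostat_perm h0.
have h0S i : (p - k <= i)%N -> ostat h0 i = 0.
  move=> pki; apply: (@ostat_eq0 _ _ _ (~: S)) => [j|].
    by rewrite inE negbK mxE => ->.
  by rewrite cardsCs finset.setCK card_topset// card_ord.
have penbh : \sum_(i < p | (i < k)%N) lam i * `|bh (s i) 0| +
    \sum_(0 <= i < p - k) lam (k + i)%N * ostat h0 i <= penalty lam bh.
  (* u lists the entries of the estimate on S, in the order of beta, followed by
     its sorted entries outside S; its partial sums are sums over sets. *)
  pose f (i : nat) : R := if insub i is Some i' then `|bh (s i') 0| else 0.
  have fE (i : 'I_p) : f i = `|bh (s i) 0| by rewrite /f valK.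
  have sumf m : (m <= p)%N -> \sum_(0 <= i < m) f i = \sum_(j in topset s m) `|bh j 0|.
    move=> mp; rewrite sum_topset big_mkord (big_ord_narrow mp).
    by apply: eq_bigr => i _; rewrite -fE.
  pose u (i : nat) : R := if (i < k)%N then f i else ostat h0 (i - k).
  have sumu m : \sum_(0 <= i < m) u i =
      \sum_(0 <= i < minn m k) f i + \sum_(0 <= i < m - k) ostat h0 i.
    have [mk|km] := leqP m k.
      rewrite [(m - k)%N](eqP mk) [X in _ + X]big_geq// addr0.
      by apply: eq_big_nat => i /andP[_ im]; rewrite /u (leq_trans im mk).
    rewrite /u sum_nat_split; last exact: ltnW.
    by congr (_ + _); apply: eq_bigr => i _; rewrite addKn.
  rewrite (_ : _ + _ = \sum_(0 <= i < p) lam i * u i).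
    apply: abel_le => // m mp; rewrite sumu sumf ?geq_min ?kp ?orbT//.
    pose A := topset s (minn m k); pose B := topset s0 (m - k).
    have AS : A \subset S.
      apply/fintype.subsetP => j; rewrite -[j](permKV s) !mem_topset.
      by rewrite leq_min => /andP[].
    have dAB : fintype.disjoint (mem A) (mem (B :\: S)).
      rewrite fintype.disjoint_sym; apply: fintype.disjointWr AS _.
      by rewrite -finset.setI_eq0 finset.setDE -finset.setIA (finset.setIC (~: S)) finset.setICr finset.setI0.
    have mkp : (m - k <= p)%N by rewrite (leq_trans (leq_subr _ _)).
    apply: le_trans (@top_sum _ p bh (A :|: (B :\: S)) m _); last first.
      rewrite (leq_trans (leq_card_setU _ _).1)// card_topset ?geq_min ?kp ?orbT//.
      rewrite (leq_trans (leq_add (leqnn _) (subset_leq_card (finset.subsetDl _ _))))//.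
      by rewrite card_topset// minnE subnK// leq_subr.
    rewrite [leRHS](eq_bigl [predU A & (B :\: S)]) => [|j]; last by rewrite !inE.
    rewrite bigU//= lerD2l -(top_sum_topset sb0 mkp).
    rewrite (bigID (mem S)) /= big1 ?add0r => [|j /andP[_ jS]]; last first.
      by rewrite mxE jS normr0.
    rewrite le_eqVlt; apply/orP; left; apply/eqP.
    apply: eq_big => [j|j /andP[_ jS]]; first by rewrite inE andbC.
    by rewrite mxE (negbTE jS) !mxE betaS// subr0.
  transitivity (\sum_(0 <= i < p)
      (if (i < k)%N then lam i * f i else lam i * ostat h0 (i - k))); last first.
    by apply: eq_bigr => i _; rewrite /u; case: ifP.
  rewrite sum_nat_split//; congr (_ + _).
    rewrite big_mkord (big_ord_narrow kp); apply: eq_bigr => i _.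
    by rewrite -fE.
  by apply: eq_bigr => i _; rewrite addKn.
have penbeta : penalty lam beta = \sum_(i < p | (i < k)%N) lam i * `|beta (s i) 0|.
  rewrite (penaltyE lam sb) (bigID (fun i : 'I_p => (i < k)%N)) /=.
  rewrite [X in _ + X]big1 ?addr0// => i ik.
  by rewrite betaS ?normr0 ?mulr0// mem_topset.
have sumh0 (F : nat -> R) : \sum_(0 <= i < p) F i * ostat h0 i =
    \sum_(0 <= i < p - k) F i * ostat h0 i.
  have Z : \sum_(p - k <= i < p) F i * ostat h0 i = 0.
    rewrite big_nat_cond big1// => i /andP[/andP[pki _] _].
    by rewrite h0S// mulr0.
  by rewrite [LHS](big_cat_nat (n := (p - k)%N))//= ?leq_subr// Z addr0.
pose D i := Num.max 0 (ostat g i - lam (k + i)%N).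
have gh : dot g h <= \sum_(i < p | (i < k)%N) `|g (s i) 0| * `|h (s i) 0| +
    \sum_(0 <= i < p - k) ostat g i * ostat h0 i.
  rewrite -(sum_topset s k (fun j => `|g j 0| * `|h j 0|)) -/S.
  rewrite /dot (bigID (mem S)) /= lerD//.
    by apply: ler_sum => j _; rewrite -normrM ler_norm.
  have : penalty (ostat h0) g <= \sum_(0 <= i < p - k) ostat g i * ostat h0 i.
    by rewrite /penalty -sumh0; under eq_bigr do rewrite mulrC.
  apply: le_trans.
  have wh0 : weights p (ostat h0).
    by split => i _; [exact: ostat_ge0|exact: ostat_mono].
  apply: le_trans (penalty_perm g s0 wh0).
  rewrite [leRHS](eq_bigr (fun i => `|h0 (s0 i) 0| * `|g (s0 i) 0|)); last first.
    by move=> i _; rewrite sb0.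
  have <- : \sum_j `|h0 j 0| * `|g j 0| = \sum_i `|h0 (s0 i) 0| * `|g (s0 i) 0|.
    by rewrite [LHS](reindex_inj (@perm_inj _ s0)).
  rewrite [leRHS](bigID (mem S)) /= [X in _ <= X + _]big1 ?add0r; last first.
    by move=> j jS; rewrite mxE jS normr0 mul0r.
  apply: ler_sum => j jS; rewrite !mxE (negbTE jS) -normrM mulrC.
  by rewrite (_ : bh j 0 - beta j 0 = h j 0) ?mxE// ler_norm.
have hh : dot h h <= \sum_(i < p | (i < k)%N) (lam i + `|g (s i) 0|) * `|h (s i) 0| +
    \sum_(0 <= i < p - k) D i * ostat h0 i.
  have := vi beta.
  have -> : dot (beta + g - bh) (beta - bh) = dot h h - dot g h.
    by rewrite /dot -sumrB; apply: eq_bigr => i _; rewrite !mxE; ring.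
  rewrite lerBlDr => /le_trans; apply.
  have H1 : \sum_(i < p | (i < k)%N) lam i * `|beta (s i) 0| <=
      \sum_(i < p | (i < k)%N) lam i * `|bh (s i) 0| +
      \sum_(i < p | (i < k)%N) lam i * `|h (s i) 0|.
    rewrite -big_split/=; apply: ler_sum => i _; rewrite -mulrDr ler_wpM2l ?l0//.
    have -> : beta (s i) 0 = bh (s i) 0 - h (s i) 0 by rewrite !mxE; ring.
    exact: ler_normB.
  have H2 : \sum_(i < p | (i < k)%N) (lam i + `|g (s i) 0|) * `|h (s i) 0| =
      \sum_(i < p | (i < k)%N) lam i * `|h (s i) 0| +
      \sum_(i < p | (i < k)%N) `|g (s i) 0| * `|h (s i) 0|.
    by rewrite -big_split/=; apply: eq_bigr => i _; rewrite mulrDl.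
  have H3 : \sum_(0 <= i < p - k) ostat g i * ostat h0 i <=
      \sum_(0 <= i < p - k) lam (k + i)%N * ostat h0 i +
      \sum_(0 <= i < p - k) D i * ostat h0 i.
    rewrite -big_split/=; apply: ler_sum => i _; rewrite -mulrDl.
    by rewrite ler_wpM2r ?ostat_ge0// -lerBlDl le_max lexx orbT.
  rewrite penbeta H2; lra.
have hsplit : dot h h = \sum_(i < p | (i < k)%N) `|h (s i) 0| ^+ 2 +
    \sum_(0 <= i < p - k) ostat h0 i ^+ 2.
  rewrite -(sum_topset s k (fun j => `|h j 0| ^+ 2)) -/S.
  under [X in _ + X]eq_bigr do rewrite expr2.
  rewrite -sumh0 big_mkord.
  rewrite (ostat_sum (fun x => x * x) sb0) /dot (bigID (mem S)) /=.
  congr (_ + _).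
    by apply: eq_bigr => j _; rewrite real_normK ?num_real// expr2.
  rewrite [RHS](bigID (mem S)) /= [X in _ = X + _]big1 ?add0r; last first.
    by move=> j jS; rewrite mxE jS normr0 mul0r.
  apply: eq_bigr => j jS; rewrite [h0 _ _]mxE (negbTE jS).
  by rewrite -!expr2 real_normK ?num_real.
have amgm : dot h h <= \sum_(i < p | (i < k)%N) (lam i + `|g (s i) 0|) ^+ 2 +
    \sum_(0 <= i < p - k) D i ^+ 2.
  have H1 : \sum_(i < p | (i < k)%N) (lam i + `|g (s i) 0|) * `|h (s i) 0| <=
      2^-1 * \sum_(i < p | (i < k)%N) (lam i + `|g (s i) 0|) ^+ 2 +
      2^-1 * \sum_(i < p | (i < k)%N) `|h (s i) 0| ^+ 2.
    rewrite !mulr_sumr -big_split/=; apply: ler_sum => i _.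
    have := sqr_ge0 (lam i + `|g (s i) 0| - `|h (s i) 0|); nra.
  have H2 : \sum_(0 <= i < p - k) D i * ostat h0 i <=
      2^-1 * \sum_(0 <= i < p - k) D i ^+ 2 +
      2^-1 * \sum_(0 <= i < p - k) ostat h0 i ^+ 2.
    rewrite !mulr_sumr -big_split/=; apply: ler_sum => i _.
    have := sqr_ge0 (D i - ostat h0 i); nra.
  lra.
rewrite norm2_dot -/h; apply: (le_trans amgm); rewrite lerD2r.
rewrite (sum_topset s k (fun j => g j 0 ^+ 2)).
rewrite big_mkord.
rewrite (_ : \sum_(i < k) lam i ^+ 2 = \sum_(i < p | (i < k)%N) lam i ^+ 2); last first.
  by rewrite (big_ord_narrow kp).
rewrite !mulr_sumr -big_split/=; apply: ler_sum => i _.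
rewrite -[in leRHS](real_normK (num_real (g (s i) 0))).
set x := lam i; set y := `|_|.
have -> : (1 + d) * x ^+ 2 + (1 + d^-1) * y ^+ 2 = (x + y) ^+ 2 + d^-1 * (d * x - y) ^+ 2.
  by field; rewrite gt_eqF.
by rewrite lerDl mulr_ge0// ?invr_ge0 ?sqr_ge0// ltW.
Qed.

End slope_upper_bound.

Section slope_lower_bound.
Context {R : realType}.

Definition spike p (S : {set 'I_p}) (M : R) : 'cV[R]_p :=
  \col_j (if j \in S then M else 0).

(** Since S carries the k largest entries of b, the m largest entries include
    min(m, k) elements of S for every m; all partial sums of order statistics
    therefore grow by at least a * min(m, k). *)
Lemma penalty_shift p k lam (S : {set 'I_p}) (b c : 'cV[R]_p) (a : R) :
  weights p lam -> #|S| = k ->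
  (forall j, j \in S -> `|c j 0| = `|b j 0| + a) ->
  (forall j, j \notin S -> c j 0 = b j 0) -> 0 <= a ->
  (forall i j, i \in S -> j \notin S -> `|b j 0| < `|b i 0|) ->
  penalty lam b + a * \sum_(0 <= i < k) lam i <= penalty lam c.
Proof.
move=> [l0 lm] Sk cS cNS a0 top.
have [s sb] := ostat_perm b.
have kp : (k <= p)%N by rewrite -Sk -[leqRHS]card_ord max_card.
pose u (i : nat) : R := ostat b i + (if (i < k)%N then a else 0).
rewrite (_ : _ + _ = \sum_(0 <= i < p) lam i * u i).
  apply: abel_le => // m mp.
  pose A := topset s m.
  have cA : #|A| = m by rewrite card_topset.
  apply: le_trans (@top_sum _ p c A m _); last by rewrite cA.
  rewrite big_split/= -(top_sum_topset sb mp) -/A.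
  have minmk : (minn m k <= #|A :&: S|)%N.
    have [/fintype.subsetP AS|/fintype.subsetPn[j jA jS]] := boolP (A \subset S).
      by rewrite (finset.setIidPl _) ?cA ?geq_minl//; apply/fintype.subsetP.
    rewrite (finset.setIidPr _) ?Sk ?geq_minr//; apply/fintype.subsetP => i iS.
    apply/negPn/negP => iA; have := top _ _ iS jS.
    rewrite -[i](permKV s) -[j](permKV s) -!sb ltNge ostat_mono//.
    move: iA jA; rewrite -[i](permKV s) -[j](permKV s) !mem_topset !permKV -leqNgt.
    by move=> mi /ltnW jm; apply: leq_trans jm mi.
  have -> : \sum_(0 <= i < m) (if (i < k)%N then a else 0) = a * (minn m k)%:R.
    have [mk|km] := leqP m k.
      rewrite (eq_big_nat _ _ (F2 := fun=> a)) => [|i /andP[_ im]]; last first.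
        by rewrite (leq_trans im mk).
      by rewrite big_const_nat subn0 iter_addr_0 mulr_natr.
    rewrite (sum_nat_split (fun=> a) (fun=> 0)); last exact: ltnW.
    by rewrite [X in _ + X]big1// addr0 big_const_nat subn0 iter_addr_0 mulr_natr.
  apply: (@le_trans _ _ (\sum_(j in A) `|b j 0| + a * #|A :&: S|%:R)).
    by rewrite lerD2l ler_wpM2l// ler_nat.
  rewrite (bigID (mem S)) /= [leRHS](bigID (mem S)) /= addrAC.
  rewrite le_eqVlt; apply/orP; left; apply/eqP; congr (_ + _); last first.
    by apply: eq_bigr => j /andP[_ jS]; rewrite cNS.
  rewrite [RHS](eq_bigr (fun j => `|b j 0| + a)) => [|j /andP[_ /cS]//].
  rewrite big_split/=; congr (_ + _).
  by rewrite sumr_const mulr_natr; congr (_ *+ _); apply: eq_card => j; rewrite !inE.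
rewrite /penalty /u; under [RHS]eq_bigr do rewrite mulrDr.
rewrite big_split/=; congr (_ + _).
transitivity (\sum_(0 <= i < p) (if (i < k)%N then lam i * a else 0)); last first.
  by apply: eq_bigr => i _; case: ifP => //; rewrite mulr0.
rewrite (sum_nat_split (fun i => lam i * a) (fun=> 0))//.
by rewrite [X in _ + X]big1// addr0 mulr_sumr; apply: eq_bigr => i _; rewrite mulrC.
Qed.

(** If |h| exceeds L there is nothing to prove.
    Otherwise the entries of the estimate on S are well separated from the
    others, penalty_shift applies to the estimate lowered by a on S, and the
    variational inequality bounds the sum of g - h over S from below by L;
    the rest is the Cauchy-Schwarz inequality on S in the form of completed
    squares. *)
Lemma slope_lower (p k : nat) (lam : nat -> R) (S : {set 'I_p}) (d : R) :
  (0 < k)%N -> #|S| = k -> weights p lam -> 0 < d ->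
  let L := \sum_(0 <= i < k) lam i in
  let beta := spike S (4 * L + 1) in
  forall g bh : 'cV[R]_p,
    (forall b, dot (beta + g - bh) (b - bh) <= penalty lam b - penalty lam bh) ->
    (1 - d) * (L ^+ 2 / k%:R) - d^-1 * \sum_(j in S) g j 0 ^+ 2
      <= norm2 (bh - beta) ^+ 2.
Proof.
move=> k0 Sk lw d0 L beta g bh vi.
have kp : (k <= p)%N by rewrite -Sk -[leqRHS]card_ord max_card.
have L0 : 0 <= L.
  by rewrite /L big_nat_cond sumr_ge0// => i /andP[/andP[_ ik] _]; rewrite (proj1 lw)// (leq_trans ik).
have k0' : 0 < k%:R :> R by rewrite ltr0n.
have k1 : 1 <= k%:R :> R by rewrite ler1n.
pose h : 'cV[R]_p := bh - beta; rewrite -/h.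
have g0 : 0 <= d^-1 * \sum_(j in S) g j 0 ^+ 2.
  by rewrite mulr_ge0 ?invr_ge0 ?(ltW d0)// sumr_ge0// => j _; exact: sqr_ge0.
have Lk : L ^+ 2 / k%:R <= L ^+ 2 by rewrite ler_pdivrMr// ler_peMr// sqr_ge0.
have Lk0 : 0 <= L ^+ 2 / k%:R by rewrite divr_ge0// sqr_ge0.
have [big|small] := ltP (L ^+ 2) (norm2 h ^+ 2).
  by apply: le_trans (ltW big); nra.
(* As |h_j| <= L, entries of bh on S exceed 3 L + 1 and the others are at most L:
   lowering the former by a keeps them above the latter. *)
pose M := 4 * L + 1; pose a := 2 * L + 4^-1.
have hle j : `|h j 0| <= L.
  rewrite -(ler_pXn2r (n := 2))// ?nnegrE//.
  apply: le_trans small; rewrite norm2_sqr (bigD1 j)//= real_normK ?num_real//.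
  by rewrite lerDl sumr_ge0// => i _; exact: sqr_ge0.
have bhE j : bh j 0 = h j 0 + (if j \in S then M else 0).
  by rewrite !mxE subrK.
pose b : 'cV[R]_p := bh - a *: (\col_j (if j \in S then 1 else 0)).
have bE j : b j 0 = bh j 0 - (if j \in S then a else 0).
  by rewrite !mxE; case: ifP => _; rewrite ?mulr1 ?mulr0.
have shift : penalty lam b + a * L <= penalty lam bh.
  apply: (@penalty_shift p k lam S b bh a) => //.
  - move=> j jS; rewrite bE jS !bhE jS; have := hle j; rewrite ler_norml => /andP[h1 h2].
    by rewrite !ger0_norm /a /M; lra.
  - by move=> j jS; rewrite bE (negbTE jS) subr0.
  - by rewrite /a; lra.
  - move=> i j iS jS; rewrite !bE iS (negbTE jS) !bhE iS (negbTE jS) subr0 addr0.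
    have := hle i; have := hle j; rewrite ler_norml => hj /ler_normlP[h1 h2].
    apply: le_lt_trans (hle j) _; rewrite ger0_norm /a /M; lra.
have key : L <= \sum_(j in S) (g j 0 - h j 0).
  have := vi b; rewrite (_ : dot _ _ = - (a * \sum_(j in S) (g j 0 - h j 0))).
    have a0 : 0 < a by rewrite /a; lra.
    by move=> H; rewrite -(ler_pM2l a0); lra.
  rewrite /dot mulr_sumr -sumrN [RHS]big_mkcond/=; apply: eq_bigr => j _.
  by rewrite !mxE; case: ifP => _; ring.
pose c := L / k%:R.
have ck : c * k%:R = L by rewrite /c divfK// gt_eqF.
have -> : (1 - d) * (L ^+ 2 / k%:R) = (1 - d) * (c * L) by rewrite /c; ring.
have H1 : \sum_(j in S) (- 2 * c * h j 0 - c ^+ 2) <= norm2 h ^+ 2.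
  rewrite norm2_sqr [leRHS](bigID (mem S)) /= -[leLHS]addr0 lerD//; last first.
    by rewrite sumr_ge0// => i _; exact: sqr_ge0.
  by apply: ler_sum => j _; have := sqr_ge0 (h j 0 + c); nra.
apply: le_trans H1.
have H2 : \sum_(j in S) 2 * c * g j 0 <= d * (c * L) + d^-1 * \sum_(j in S) g j 0 ^+ 2.
  have -> : d * (c * L) = \sum_(j in S) d * c ^+ 2.
    by rewrite sumr_const Sk -ck -mulr_natr; ring.
  rewrite mulr_sumr -big_split/=; apply: ler_sum => j _.
  have -> : d * c ^+ 2 + d^-1 * g j 0 ^+ 2 = 2 * c * g j 0 + d^-1 * (d * c - g j 0) ^+ 2.
    by field; rewrite gt_eqF.
  by rewrite lerDl mulr_ge0 ?invr_ge0 ?sqr_ge0 ?(ltW d0).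
have c0 : 0 <= c by rewrite /c divr_ge0// ltW.
have H3 : \sum_(j in S) (- 2 * c * h j 0 - c ^+ 2) =
    2 * c * \sum_(j in S) (g j 0 - h j 0) - \sum_(j in S) 2 * c * g j 0 - c * L.
  rewrite (_ : c * L = \sum_(j in S) c ^+ 2); last first.
    by rewrite sumr_const Sk -ck -mulr_natr; ring.
  by rewrite mulr_sumr -!sumrB; apply: eq_bigr => j _; ring.
by rewrite H3; nra.
Qed.

End slope_lower_bound.

(** * Integration against a normal law *)

(** The image measure as a measure structure, with the measurability proof
    explicit so that the structure can be given by name. *)
Definition image_measure d d' (T1 : measurableType d) (T2 : measurableType d')
    (R : realFieldType) (m : {measure set T1 -> \bar R}) (f : T1 -> T2)
    (mf : measurable_fun setT f) : {measure set T2 -> \bar R} :=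
  measure_function_pushforward__canonical__measure_function_Measure m mf.

Section gaussian_density.
Context {R : realType}.
Notation mu := (@lebesgue_measure R).
Notation gam := (@normal_prob R 0 1).
Notation phi := (@normal_pdf R 0 1).
Local Open Scope ereal_scope.

(** The Radon-Nikodym derivative of the normal law coincides almost everywhere
    with its density. *)
Lemma ge0_integral_normal (m s : R) (f : R -> \bar R) : measurable_fun [set: R] f ->
  (forall x, 0 <= f x) ->
  \int[normal_prob m s]_x f x = \int[mu]_x (f x * (normal_pdf m s x)%:E).
Proof.
move=> mf f0; have dom := normal_prob_dominates m s.
rewrite -(Radon_Nikodym_SigmaFinite.change_of_variables dom f0 measurableT mf).
have mphi : measurable_fun setT (fun x => (normal_pdf m s x)%:E).
  by apply/measurable_EFinP; exact: measurable_normal_pdf.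
have mRN := measurable_int _ (Radon_Nikodym_SigmaFinite.f_integrable dom).
apply: ae_eq_integral => //.
- exact: emeasurable_funM.
- exact: emeasurable_funM.
- apply: ae_eqe_mul2l; apply: integral_ae_eq => //.
    exact: Radon_Nikodym_SigmaFinite.f_integrable.
  by move=> E _ mE; rewrite -Radon_Nikodym_SigmaFinite.f_integral.
Qed.

(** Both sides are integrals against measures that agree on half-open intervals,
    hence are equal. *)
Lemma ge0_integral_affine (s t : R) (f : R -> \bar R) : (s != 0)%R ->
  measurable_fun [set: R] f -> (forall x, 0 <= f x) ->
  \int[mu]_x f x = `|s|%:E * \int[mu]_x f (s * x + t)%R.
Proof.
move=> s0 mf f0.
pose a (x : measurableTypeR R) : measurableTypeR R := (s * x + t)%R.
have ma : measurable_fun setT a.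
  by apply: measurable_funD => //; exact: measurable_funM.
pose m' := mscale (NngNum (normr_ge0 s)) (image_measure mu ma).
have E A : measurable A -> mu A = m' A.
  apply: lebesgue_measure_unique => _ [[u v]] _ <-.
  transitivity (`|s|%:E * mu (a @^-1` `]u, v]%classic)); last by [].
  wlog uv : u v / (u < v)%R => [H|].
    have [uv|vu] := ltP u v; first exact: H.
    rewrite set_itv_ge ?measure0 ?preimage_set0 ?measure0 ?mule0//=.
    by rewrite -leNgt bnd_simp.
  rewrite lebesgue_measure_itv/= lte_fin uv.
  have [sp|sn] := ltP 0%R s.
    rewrite (_ : a @^-1` _ = `](u - t) / s, (v - t) / s]%classic)%R; last first.
      apply/seteqP; split => x /=; rewrite /a !in_itv/= ltr_pdivrMr// ler_pdivlMr//;
      by rewrite ltrBlDr lerBrDr mulrC.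
    rewrite lebesgue_measure_itv/= lte_fin ltr_pM2r ?invr_gt0// ltrD2r uv.
    rewrite ger0_norm ?(ltW sp)// -!EFinB -EFinM; congr EFin.
    by field.
  have {}sn : (s < 0)%R by rewrite lt_neqAle s0.
  rewrite (_ : a @^-1` _ = `[(v - t) / s, (u - t) / s[%classic)%R; last first.
    apply/seteqP; split => x /=; rewrite /a !in_itv/= ler_ndivrMr// ltr_ndivlMr//;
    by rewrite ltrBlDr lerBrDr mulrC andbC.
  rewrite lebesgue_measure_itv/= lte_fin ltr_nM2r ?invr_lt0// ltrD2r uv.
  rewrite ltr0_norm// -!EFinB -EFinM; congr EFin.
  by field.
rewrite (eq_measure_integral m')//; last by move=> A mA _; exact: E.
rewrite ge0_integral_mscale//= ge0_integral_pushforward//.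
Qed.

End gaussian_density.

(** * The standard normal distribution function *)

Section gaussian_cdf.
Context {R : realType}.
Notation mu := (@lebesgue_measure R).
Notation gam := (@normal_prob R 0 1).
Notation phi := (@normal_pdf R 0 1).

Lemma phiE (x : R) : phi x = normal_peak 1 * expR (- (x ^+ 2 / 2)).
Proof.
rewrite normal_pdfE ?oner_neq0// /normal_fun subr0 expr1n mulNr.
by [].
Qed.

Lemma peak_gt0 : 0 < normal_peak (1 : R).
Proof. by apply: normal_peak_gt0; exact: oner_neq0. Qed.

Lemma phi_gt0 (x : R) : 0 < phi x.
Proof. by rewrite phiE mulr_gt0 ?peak_gt0 ?expR_gt0. Qed.

Lemma cont_phi : continuous (phi : R -> R).
Proof. by apply: continuous_normal_pdf; exact: oner_neq0. Qed.

Lemma is_derive_Phi (x : R) : is_derive x 1 (@Phi R) (phi x).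
Proof.
have [] := @continuous_FTC1 R phi -oo%O x (x + 1).
- by rewrite ltrDl.
- apply: (integrableS measurableT) => //; exact: integrable_normal_pdf.
- by rewrite ltNyr.
- exact: cont_phi.
move=> dF F'; apply: DeriveDef; first exact: dF.
by rewrite -F' derive1E.
Qed.

Lemma is_derive_phi (x : R) : is_derive x 1 phi (- x * phi x).
Proof.
rewrite (_ : phi = fun x => normal_peak 1 * expR (- (x ^+ 2 / 2))); last first.
  by apply/funext => y; rewrite phiE.
apply: is_derive_eq; rewrite /GRing.scale/=.
by field.
Qed.

Lemma Phi_fin (x : R) : (Phi x)%:E = gam `]-oo, x].
Proof. by rewrite /Phi fineK// fin_num_measure. Qed.

Lemma Phi_mono (x y : R) : x <= y -> Phi x <= Phi y.
Proof.
by move=> xy; rewrite -lee_fin !Phi_fin le_measure ?inE//; exact: subitvPr.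
Qed.

Lemma cont_Phi : continuous (@Phi R).
Proof.
by move=> x; apply/differentiable_continuous/derivable1_diffP; have [] := is_derive_Phi x.
Qed.

Let idg : measurableTypeR R -> R := idfun.
#[local] HB.instance Definition _ :=
  @isMeasurableFun.Build _ _ _ _ idg (@measurable_id _ _ setT).

Lemma Phi_cdf : (@Phi R) = fine \o cdf (idg : {RV gam >-> R}).
Proof. by []. Qed.

Lemma cvg_Phiy : (@Phi R) x @[x --> +oo] --> (1 : R).
Proof. by rewrite Phi_cdf; apply: fine_cvg; exact: cvg_cdfy1. Qed.

Lemma cvg_PhiNy : (@Phi R) x @[x --> -oo] --> (0 : R).
Proof. by rewrite Phi_cdf; apply: fine_cvg; exact: cvg_cdfNy0. Qed.

(** Intermediate value theorem between the limits 0 and 1. *)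
Lemma Phi_surj (y : R) : 0 < y < 1 -> exists x, Phi x = y.
Proof.
move=> /andP[y0 y1].
have [b yb] : exists b, y < Phi b.
  have /cvgr_gt/(_ _ y1) := cvg_Phiy.
  by move=> /filter_ex[b]; exists b.
have [a ya] : exists a, Phi a < y.
  have /cvgr_lt/(_ _ y0) := cvg_PhiNy.
  by move=> /filter_ex[a]; exists a.
have ab : a <= b.
  by rewrite leNgt; apply/negP => /ltW/Phi_mono; lra.
have abP : Phi a <= Phi b by rewrite ltW// (lt_trans ya).
have H : Num.min (Phi a) (Phi b) <= y <= Num.max (Phi a) (Phi b).
  by rewrite (min_idPl abP) (max_idPr abP) !ltW.
have cP : {within `[a, b], continuous (@Phi R)}.
  by apply: continuous_subspaceT; exact: cont_Phi.
by have [c _ <-] := IVT ab cP H; exists c.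
Qed.

Lemma Phi_invK (y : R) : 0 < y < 1 -> Phi (Phi_inv y) = y.
Proof.
move=> /Phi_surj[x xy]; apply: (@pinvK _ _ (fun=> 0) setT (@Phi R)).
by rewrite inE; exists x.
Qed.

(** The density is O(x^-4), since expR (x^2/2) >= x^4/8. *)
Lemma phi_decay (f : R -> R) (N : R) :
  (forall x, N <= x -> `|f x| <= x ^+ 2 * phi x) -> f x @[x --> +oo] --> (0 : R).
Proof.
move=> fN; apply/cvgr0Pnorm_le => e e0.
near=> x.
have x1 : 1 <= x by near: x; apply: nbhs_pinfty_ge; rewrite num_real.
have xN : N <= x by near: x; apply: nbhs_pinfty_ge; rewrite num_real.
have xe : 8 * normal_peak 1 / e <= x by near: x; apply: nbhs_pinfty_ge; rewrite num_real.
apply: le_trans (fN x xN) _; rewrite phiE expRN.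
have x0 : 0 < x by exact: lt_le_trans x1.
have He : x ^+ 4 / 8 <= expR (x ^+ 2 / 2).
  apply: le_trans (expR_ge1Dxn 1 _); last by rewrite divr_ge0// sqr_ge0.
  rewrite (_ : 2`!%:R = 2 :> R)//.
  have -> : x ^+ 4 / 8 = (x ^+ 2 / 2) ^+ 2 / 2 by field.
  by rewrite lerDr.
have p0 := peak_gt0.
have Hi : (expR (x ^+ 2 / 2))^-1 <= 8 / x ^+ 4.
  by rewrite -[leRHS]invrK invf_div lef_pV2 ?posrE ?expR_gt0// divr_gt0 ?exprn_gt0.
apply: (@le_trans _ _ (x ^+ 2 * (normal_peak 1 * (8 / x ^+ 4)))).
  by apply: ler_wpM2l; [exact: sqr_ge0|apply: ler_wpM2l => //; exact: ltW].
rewrite (_ : x ^+ 2 * (normal_peak 1 * (8 / x ^+ 4)) = 8 * normal_peak 1 / x ^+ 2); last first.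
  by field; rewrite gt_eqF.
rewrite ler_pdivrMr ?exprn_gt0//; move: xe; rewrite ler_pdivrMr// => xe.
apply: (le_trans xe); rewrite mulrC ler_wpM2l ?(ltW e0)//.
by rewrite expr2 ler_peMl// ltW.
Unshelve. all: by end_near. Qed.

Lemma ftc_halfline (f F : R -> R) (a l : R) :
  (forall x, a <= x -> 0 <= f x) -> continuous f ->
  (forall x : R, is_derive x 1 F (f x)) -> F x @[x --> +oo] --> l ->
  (\int[mu]_(x in `[a, +oo[) (f x)%:E = (l - F a)%:E)%E.
Proof.
move=> f0 cf dF Fl; rewrite EFinB; apply: ge0_continuous_FTC2y => //.
- exact: continuous_subspaceT.
- have cF : continuous F.
    by move=> x; apply/differentiable_continuous/derivable1_diffP; have [] := dF x.
  by apply: cvg_at_right_filter; exact: cF.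
- by move=> x _; rewrite derive1E; have [_ ->] := dF x.
Qed.

#[local] Existing Instance is_derive_Phi.
#[local] Existing Instance is_derive_phi.

Lemma cvg_phi : phi x @[x --> +oo] --> (0 : R).
Proof.
apply: (@phi_decay _ 1) => x x1; rewrite gtr0_norm ?phi_gt0//.
rewrite ler_peMl ?(ltW (phi_gt0 _))// expr2 mulr_ege1//.
Qed.

(** The antiderivative is - phi x - t * Phi x. *)
Lemma gauss_excess_mean (t : R) : 0 <= t ->
  (\int[mu]_(x in `[t, +oo[) ((x - t) * phi x)%:E = (phi t - t * (1 - Phi t))%:E)%E.
Proof.
move=> t0; pose F x : R := - phi x - t * Phi x; pose f x : R := (x - t) * phi x.
have f0 x : t <= x -> 0 <= f x.
  by move=> tx; rewrite mulr_ge0 ?subr_ge0// ltW// phi_gt0.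
have cf : continuous f.
  move=> x; apply: cvgM; last exact: cont_phi.
  by apply: cvgB; [exact: cvg_id|exact: cvg_cst].
have dF (x : R) : is_derive x 1 F (f x).
  by apply: is_derive_eq; rewrite /GRing.scale/= /f; ring.
have Fl : F x @[x --> +oo] --> - t.
  rewrite -[X in _ --> X](_ : - 0 - t * 1 = - t); last by ring.
  apply: cvgB; first by apply: cvgN; exact: cvg_phi.
  by apply: cvgM; [exact: cvg_cst|exact: cvg_Phiy].
by rewrite (ftc_halfline f0 cf dF Fl) /F; congr EFin; ring.
Qed.

(** The factor x makes the antiderivative explicit: it is
    - (x - t) * phi x + Phi x. As x >= t on the half-line, this
    integral is an upper bound for t times the mean excess. *)
Lemma gauss_weighted_excess_mean (t : R) : 0 <= t ->
  (\int[mu]_(x in `[t, +oo[) (x * (x - t) * phi x)%:E = (1 - Phi t)%:E)%E.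
Proof.
move=> t0; pose F x : R := - (x - t) * phi x + Phi x.
pose f x : R := x * (x - t) * phi x.
have f0 x : t <= x -> 0 <= f x.
  by move=> tx; rewrite !mulr_ge0 ?subr_ge0 ?(le_trans t0 tx) ?(ltW (phi_gt0 x)).
have cf : continuous f.
  move=> x; apply: cvgM; last exact: cont_phi.
  by apply: cvgM; [|apply: cvgB; [|exact: cvg_cst]]; exact: cvg_id.
have dF (x : R) : is_derive x 1 F (f x).
  by apply: is_derive_eq; rewrite /GRing.scale/= /f; ring.
have Fl : F x @[x --> +oo] --> (1 : R).
  rewrite -[X in _ --> X]add0r; apply: cvgD; last exact: cvg_Phiy.
  apply: (@phi_decay _ (t + 1)) => x tx.
  rewrite normrM (gtr0_norm (phi_gt0 _)) normrN ger0_norm; last by lra.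
  by rewrite ler_wpM2r ?(ltW (phi_gt0 _))//; nra.
by rewrite (ftc_halfline f0 cf dF Fl) /F; congr EFin; ring.
Qed.

(** The antiderivative is - (x - t)^2 * phi x - 2 * phi x - 2 * t * Phi x; the
    value is twice the mean excess, which makes the second moment of the
    excess follow from the first one. *)
Lemma gauss_weighted_excess_sqr (t : R) : 0 <= t ->
  (\int[mu]_(x in `[t, +oo[) (x * (x - t) ^+ 2 * phi x)%:E =
   (2 * (phi t - t * (1 - Phi t)))%:E)%E.
Proof.
move=> t0; pose F x : R := - (x - t) ^+ 2 * phi x - 2 * phi x - 2 * t * Phi x.
pose f x : R := x * (x - t) ^+ 2 * phi x.
have f0 x : t <= x -> 0 <= f x.
  by move=> tx; rewrite !mulr_ge0 ?subr_ge0 ?sqr_ge0 ?(le_trans t0 tx) ?(ltW (phi_gt0 x)).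
have cf : continuous f.
  by move=> x; apply/differentiable_continuous/derivable1_diffP; exact: ex_derive.
have dF (x : R) : is_derive x 1 F (f x).
  by apply: is_derive_eq; rewrite /GRing.scale/= /f; ring.
have Fl : F x @[x --> +oo] --> - 2 * t.
  rewrite -[X in _ --> X](_ : 0 - 2 * 0 - 2 * t * 1 = - 2 * t); last by ring.
  apply: cvgB; last by apply: cvgM; [exact: cvg_cst|exact: cvg_Phiy].
  apply: cvgB; last by apply: cvgM; [exact: cvg_cst|exact: cvg_phi].
  apply: (@phi_decay _ (t + 1)) => x tx.
  rewrite normrM (gtr0_norm (phi_gt0 _)) normrN ger0_norm ?sqr_ge0//.
  by rewrite ler_wpM2r ?(ltW (phi_gt0 _))//; nra.
by rewrite (ftc_halfline f0 cf dF Fl) /F; congr EFin; ring.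
Qed.

End gaussian_cdf.

(** * Tails and excesses of a standard normal variable *)

Section gaussian_tail.
Context {R : realType}.
Notation mu := (@lebesgue_measure R).
Notation gam := (@normal_prob R 0 1).
Notation phi := (@normal_pdf R 0 1).

(** The two-sided tail, the probability that |x| > t. *)
Definition tail (t : R) : R := 2 * (1 - Phi t).
Definition excess (t x : R) : R := Num.max 0 (`|x| - t).
Let half_excess (t x : R) : R := Num.max 0 (x - t).

Lemma ge0_integral_gauss_sym (f : R -> \bar R) : measurable_fun [set: R] f ->
  (forall x, 0 <= f x)%E ->
  (\int[gam]_x f x = \int[gam]_x f (- x)%R)%E.
Proof.
move=> mf f0.
have mfN : measurable_fun [set: R] (fun x => f (- x)%R) by exact: measurableT_comp.
rewrite !ge0_integral_normal//.
rewrite (@ge0_integral_affine _ (-1) 0) ?oppr_eq0 ?oner_neq0//.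
- rewrite normrN1 mul1e; apply: eq_integral => x _.
  by rewrite mulN1r addr0 !phiE sqrrN.
- apply: emeasurable_funM => //; apply/measurable_EFinP.
  exact: measurable_normal_pdf.
- by move=> x; rewrite mule_ge0// lee_fin normal_pdf_ge0.
Qed.

Lemma measurable_half_excess t : measurable_fun [set: R] (half_excess t).
Proof. by apply: measurable_maxr => //; exact: measurable_funB. Qed.

Lemma measurable_excess t : measurable_fun [set: R] (excess t).
Proof.
apply: measurable_maxr => //; apply: measurable_funB => //.
Qed.

Lemma half_excess_ge0 t x : 0 <= half_excess t x. Proof. by rewrite le_max lexx. Qed.
Lemma excess_ge0 t x : 0 <= excess t x. Proof. by rewrite le_max lexx. Qed.

(** For t >= 0 the excess of |x| is the sum of the excesses of x and - x, at
    most one of which is nonzero. *)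
Lemma integral_excess (t : R) (r : nat) : 0 <= t -> (0 < r)%N ->
  (\int[gam]_x (excess t x ^+ r)%:E =
   2%:E * \int[mu]_(x in `[t, +oo[) ((x - t) ^+ r * phi x)%:E)%E.
Proof.
move=> t0 r0.
have mhalf : measurable_fun [set: R] (fun x => (half_excess t x ^+ r)%:E).
  by apply/measurable_EFinP; apply: measurable_funX; exact: measurable_half_excess.
have mhalfN : measurable_fun [set: R] (fun x => (half_excess t (- x) ^+ r)%:E).
  apply: (@measurableT_comp _ _ _ _ _ _ (fun x => (half_excess t x ^+ r)%:E)) => //.
have e x : excess t x ^+ r = half_excess t x ^+ r + half_excess t (- x) ^+ r.
  rewrite /excess /half_excess; have [x0|x0] := leP 0 x.
    rewrite ger0_norm// (@max_l _ _ 0 (- x - t)); last by lra.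
    by rewrite expr0n gtn_eqF// addr0.
  rewrite ltr0_norm// (@max_l _ _ 0 (x - t)); last by lra.
  by rewrite expr0n gtn_eqF// add0r.
under eq_integral do rewrite e EFinD.
rewrite ge0_integralD//; last 2 first.
  by move=> x _; rewrite lee_fin exprn_ge0// half_excess_ge0.
  by move=> x _; rewrite lee_fin exprn_ge0// half_excess_ge0.
rewrite -(ge0_integral_gauss_sym mhalf); last first.
  by move=> x; rewrite lee_fin exprn_ge0// half_excess_ge0.
rewrite ge0_integral_normal//; last first.
  by move=> x; rewrite lee_fin exprn_ge0// half_excess_ge0.
rewrite -mule2n mule_natl; congr (_ *+ _)%E.
rewrite [RHS]integral_mkcond; apply: eq_integral => x _.
rewrite patchE mem_setE in_itv/= andbT -EFinM; case: ifPn => tx.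
  by rewrite /half_excess max_r// subr_ge0.
by rewrite /half_excess max_l ?expr0n ?gtn_eqF ?mul0r// subr_le0 ltW// ltNge.
Qed.

Lemma excess_mean_bound (t : R) : 0 < t -> (phi t - t * (1 - Phi t)) * t <= 1 - Phi t.
Proof.
move=> t0; rewrite -lee_fin EFinM -(gauss_excess_mean (ltW t0)) -(gauss_weighted_excess_mean (ltW t0)).
rewrite -ge0_integralZr//.
- apply: ge0_le_integral => //.
  + move=> x; rewrite /= in_itv/= andbT => tx.
    by rewrite mule_ge0// lee_fin ?(ltW t0)// mulr_ge0 ?subr_ge0// ltW// phi_gt0.
  + apply: emeasurable_funM => //; apply/measurable_EFinP/measurable_funTS.
    apply: measurable_funM; last exact: measurable_normal_pdf.
    exact: measurable_funB.
  + apply/measurable_EFinP/measurable_funTS.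
    apply: measurable_funM; last exact: measurable_normal_pdf.
    by apply: measurable_funM => //; exact: measurable_funB.
  + move=> x; rewrite /= in_itv/= andbT => tx.
    rewrite -EFinM lee_fin mulrAC ler_wpM2r ?(ltW (phi_gt0 _))// mulrC.
    by rewrite ler_wpM2r ?subr_ge0.
- apply/measurable_EFinP/measurable_funTS.
  apply: measurable_funM; last exact: measurable_normal_pdf.
  exact: measurable_funB.
- move=> x; rewrite /= in_itv/= andbT => tx.
  by rewrite lee_fin mulr_ge0 ?subr_ge0// ltW// phi_gt0.
by rewrite lee_fin ltW.
Qed.

(** Like an exponential variable of rate t, the excess over t has conditional
    mean at most 1 / t. *)
Lemma excess_mean_le (t : R) : 0 < t ->
  (\int[gam]_x (excess t x)%:E <= (tail t / t)%:E)%E.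
Proof.
move=> t0; have := @integral_excess t 1 (ltW t0) isT.
under eq_integral do rewrite expr1.
move=> ->; under eq_integral do rewrite expr1.
rewrite (gauss_excess_mean (ltW t0)) -EFinM lee_fin /tail ler_pdivlMr// -mulrA ler_pM2l//.
exact: excess_mean_bound.
Qed.

(** The conditional second moment is at most that of an exponential variable of
    rate t. *)
Lemma excess_sqr_le (t : R) : 0 < t ->
  (\int[gam]_x (excess t x ^+ 2)%:E <= (2 * tail t / t ^+ 2)%:E)%E.
Proof.
move=> t0; rewrite (@integral_excess t 2 (ltW t0) isT).
set I := integral _ _ _.
have mI : measurable_fun `[t, +oo[ (fun x => ((x - t) ^+ 2 * phi x)%:E).
  apply/measurable_EFinP/measurable_funTS.
  apply: measurable_funM; last exact: measurable_normal_pdf.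
  by apply: measurable_funX; exact: measurable_funB.
have I0 x : `[t, +oo[%classic x -> (0 <= ((x - t) ^+ 2 * phi x)%:E)%E.
  by rewrite lee_fin => _; rewrite mulr_ge0 ?sqr_ge0// ltW// phi_gt0.
have HI : (I * t%:E <= (2 * (phi t - t * (1 - Phi t)))%:E)%E.
  rewrite -(gauss_weighted_excess_sqr (ltW t0)) /I -ge0_integralZr//; last by rewrite lee_fin ltW.
  apply: ge0_le_integral => //.
  - by move=> x xt; rewrite mule_ge0// ?lee_fin ?(ltW t0)//; exact: I0.
  - exact: emeasurable_funM.
  - apply/measurable_EFinP/measurable_funTS.
    apply: measurable_funM; last exact: measurable_normal_pdf.
    by apply: measurable_funM => //; apply: measurable_funX; exact: measurable_funB.
  - move=> x; rewrite /= in_itv/= andbT => tx.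
    rewrite -EFinM lee_fin mulrAC ler_wpM2r ?(ltW (phi_gt0 _))// mulrC.
    by rewrite ler_wpM2r ?sqr_ge0.
have I0' : (0 <= I)%E by apply: integral_ge0 => x xt; exact: I0.
have fI : I \is a fin_num.
  rewrite ge0_fin_numE// ltey; apply/eqP => Ioo; move: HI.
  by rewrite Ioo mulyr gtr0_sg// mul1e leye_eq.
move: HI; rewrite -(fineK fI) -!EFinM !lee_fin => HI.
have := excess_mean_bound t0; set e := phi t - _ in HI * => He.
rewrite /tail ler_pdivlMr ?exprn_gt0//.
rewrite -!mulrA ler_pM2l//.
by rewrite expr2 mulrA; nra.
Qed.

Lemma tail_prob (t : R) : 0 <= t -> gam [set x | t < `|x|] = (tail t)%:E.
Proof.
move=> t0.
have -> : [set x : R | t < `|x|] = `]t, +oo[%classic `|` (-%R @^-1` `]t, +oo[%classic).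
  apply/seteqP; split => x /=; rewrite !in_itv/= !andbT.
    by rewrite ltr_normr => /orP.
  by rewrite ltr_normr => H; apply/orP.
have mN : measurable (-%R @^-1` `]t, +oo[%classic : set R).
  by rewrite opp_preimage_itvbndy.
have sym : gam (-%R @^-1` `]t, +oo[%classic) = gam `]t, +oo[%classic.
  have H A : measurable A -> gam A = (\int[gam]_x (\1_A x)%:E)%E.
    by move=> mA; rewrite integral_indic// setIT.
  rewrite !H//.
  rewrite [RHS]ge0_integral_gauss_sym//.
  by apply/measurable_EFinP; exact: measurable_indic.
have up : gam `]t, +oo[%classic = (1 - Phi t)%:E.
  rewrite EFinB Phi_fin -[1%E](@probability_setT _ _ _ gam).
  rewrite -(setvU `]-oo, t]%classic) measureU//.
  - by rewrite setCitvl addeK// fin_num_measure.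
  - by apply: measurableC.
  - by rewrite setIC setICr.
transitivity ((1 - Phi t)%:E + (1 - Phi t)%:E)%E; last first.
  by rewrite -EFinD; congr EFin; rewrite /tail; ring.
rewrite -[X in (X + _)%E]up -(etrans sym up); apply: measureU => //.
by apply/seteqP; split => x //=; rewrite !in_itv/= !andbT => -[]; lra.
Qed.

Lemma Phi0 : Phi (0 : R) = 2^-1.
Proof.
have g0 : gam [set (0 : R)] = 0%E.
  have /null_content_dominatesP := @normal_prob_dominates R 0 1.
  by apply => //; exact: lebesgue_measure_set1.
have : gam [set x | 0 < `|x|] = 1%E.
  rewrite -[1%E](@probability_setT _ _ _ gam) -(setvU [set 0]) measureU//.
  - rewrite [X in _ = (_ + X)%E]g0 adde0; congr (gam _).
    apply/seteqP; split => x /=; rewrite normr_gt0; first by move/eqP.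
    by move=> ?; apply/eqP.
  - exact: measurableC.
  - by rewrite setIC setICr.
by rewrite tail_prob// => -[]; rewrite /tail => H; lra.
Qed.

(** On the half-line x >= t, t times the tail integral of phi is at most the
    integral of x * phi x, which is phi t. *)
Lemma tail_ub (c t : R) : 0 < c -> c <= t -> tail t <= 2 * normal_peak 1 / c * expR (- (t ^+ 2 / 2)).
Proof.
move=> c0 ct; have t0 := lt_le_trans c0 ct.
have H : t * (1 - Phi t) <= phi t.
  rewrite -subr_ge0 -lee_fin -(gauss_excess_mean (ltW t0)).
  apply: integral_ge0 => x; rewrite /= in_itv/= andbT => tx.
  by rewrite lee_fin mulr_ge0 ?subr_ge0// ltW// phi_gt0.
have P1 : 0 <= 1 - Phi t.
  by rewrite subr_ge0 -lee_fin Phi_fin probability_le1.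
rewrite [leRHS](_ : _ = (2 * (normal_peak 1 * expR (- (t ^+ 2 / 2)))) / c); last by ring.
rewrite ler_pdivlMr// /tail.
move: H; rewrite phiE => H; have := ler_wpM2r P1 ct; lra.
Qed.

(** The density is at least phi (t + 1) on [t, t + 1]. *)
Lemma tail_lb (t : R) : 0 <= t -> 2 * normal_peak 1 * expR (- ((t + 1) ^+ 2 / 2)) <= tail t.
Proof.
move=> t0; rewrite /tail -mulrA ler_pM2l//.
have cP : {within `[t, t + 1], continuous (@Phi R)}.
  by apply: continuous_subspaceT; exact: cont_Phi.
have [||c ct H] := @MVT R (@Phi R) phi t (t + 1) _ _ cP.
- by rewrite ltrDl.
- by move=> x _; exact: is_derive_Phi.
have : Phi (t + 1) <= 1 by rewrite -lee_fin Phi_fin probability_le1.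
move: H ct; rewrite addrAC subrr add0r mulr1 in_itv/= => H /andP[ct tc] P1.
apply: (@le_trans _ _ (phi c)); last by lra.
rewrite phiE ler_pM2l ?peak_gt0// ler_expR lerN2.
by rewrite ler_pM2r ?invr_gt0//; nra.
Qed.

End gaussian_tail.

(** * Rotation invariance of Gaussian families *)

Section plane_rotation.
Context {R : realType}.
Notation mu := (@lebesgue_measure R).
Notation gam := (@normal_prob R 0 1).
Notation phi := (@normal_pdf R 0 1).

(** For fixed x substitute u = c x + s y for y, exchange the integrals, then for
    fixed u substitute c u - s v for x. The two Jacobians 1/|s| and |s| cancel. *)
Lemma integral_rotation (c s : R) (h : R * R -> \bar R) : s != 0 -> c ^+ 2 + s ^+ 2 = 1 ->
  measurable_fun [set: R * R] h -> (forall z, 0 <= h z)%E ->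
  (\int[mu]_x \int[mu]_y h (x, y) =
   \int[mu]_u \int[mu]_v h (c * u - s * v, s * u + c * v)%R)%E.
Proof.
move=> s0 cs mh h0.
have m1 : measurable_fun [set: R * R] (fun z : R * R => z.1) by exact: measurable_fst.
have m2 : measurable_fun [set: R * R] (fun z : R * R => z.2) by exact: measurable_snd.
have mpair (f g : R * R -> R) : measurable_fun setT f -> measurable_fun setT g ->
    measurable_fun [set: R * R] (fun z => h (f z, g z)).
  by move=> mf mg; apply: (measurableT_comp mh); exact: measurable_fun_pair.
pose k (z : R * R) := h (z.1, s^-1 * z.2 + - (s^-1 * c * z.1))%R.
have mk : measurable_fun [set: R * R] k.
  apply: mpair => //; apply: measurable_funD; first exact: measurable_funM.
  by apply: measurableT_comp => //; exact: measurable_funM.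
pose H (z : R * R) := h (c * z.1 - s * z.2, s * z.1 + c * z.2)%R.
have mH : measurable_fun [set: R * R] H.
  apply: mpair.
    by apply: measurable_funB; exact: measurable_funM.
  by apply: measurable_funD; exact: measurable_funM.
have mk1 u : measurable_fun [set: R] (fun x => k (x, u)).
  by apply: (measurableT_comp mk); exact: measurable_fun_pair.
have mh2 x : measurable_fun [set: R] (fun y => h (x, y)).
  by apply: (measurableT_comp mh); exact: measurable_fun_pair.
transitivity (\int[mu]_x (`|s^-1|%:E * \int[mu]_u k (x, u)))%E.
  apply: eq_integral => x _.
  by rewrite (@ge0_integral_affine _ s^-1 (- (s^-1 * c * x))) ?invr_eq0.
rewrite ge0_integralZl//; last 2 first.
- by apply: (measurable_fun_fubini_tonelli_F (m2 := mu) k mk) => z; exact: h0.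
- by move=> x _; apply: integral_ge0 => u _; exact: h0.
have -> : (\int[mu]_x \int[mu]_u k (x, u) = \int[mu]_u \int[mu]_x k (x, u))%E.
  by apply: (@fubini_tonelli _ _ _ _ _ mu mu k mk) => z; exact: h0.
transitivity (`|s^-1|%:E * \int[mu]_u (`|s|%:E * \int[mu]_v H (u, v)))%E.
  congr (_ * _)%E; apply: eq_integral => u _.
  rewrite (@ge0_integral_affine _ (- s) (c * u)) ?oppr_eq0//; last by move=> x; exact: h0.
  rewrite normrN; congr (_ * _)%E; apply: eq_integral => v _.
  rewrite /k /H/=; congr h; congr (_, _); first by ring.
  have -> : s * u = s^-1 * (u * (1 - c ^+ 2)).
    by rewrite -cs; field.
  by field.
rewrite ge0_integralZl//; last 2 first.
- by apply: (measurable_fun_fubini_tonelli_F (m2 := mu) H mH) => z; exact: h0.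
- by move=> x _; apply: integral_ge0 => u _; exact: h0.
by rewrite muleA -EFinM -normrM mulVf// normr1 mul1e.
Qed.

(** The product of the densities depends on x^2 + y^2 only, which a rotation
    preserves. *)
Lemma gauss_rotation (c s : R) (A B : set R) : s != 0 -> c ^+ 2 + s ^+ 2 = 1 ->
  measurable A -> measurable B ->
  (gam \x gam)%E [set z : R * R | A (c * z.1 + s * z.2) /\ B (- s * z.1 + c * z.2)] =
  (gam A * gam B)%E.
Proof.
move=> s0 cs mA mB; set X := [set z | _].
have m1 : measurable_fun [set: R * R] (fun z : R * R => z.1) by exact: measurable_fst.
have m2 : measurable_fun [set: R * R] (fun z : R * R => z.2) by exact: measurable_snd.
have mX : measurable X.
  rewrite (_ : X = (fun z : R * R => c * z.1 + s * z.2) @^-1` A `&`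
                   (fun z : R * R => - s * z.1 + c * z.2) @^-1` B) //.
  apply: measurableI; rewrite -[X in measurable X]setTI.
    by apply: (measurable_funD _ _) => //; exact: measurable_funM.
  by apply: (measurable_funD _ _) => //; exact: measurable_funM.
have mphi : measurable_fun [set: R] (phi : R -> R) by exact: measurable_normal_pdf.
have phi0 (x : R) : (0 <= (phi x)%:E)%E by rewrite lee_fin normal_pdf_ge0.
pose f (z : R * R) : \bar R := (\1_X z)%:E.
have mf : measurable_fun [set: R * R] f.
  by apply/measurable_EFinP; exact: measurable_indic.
have f0 z : (0 <= f z)%E by rewrite lee_fin.
pose h (z : R * R) : \bar R := (f z * (phi z.2)%:E * (phi z.1)%:E)%E.
have mh : measurable_fun [set: R * R] h.
  apply: emeasurable_funM; last first.
    by apply/measurable_EFinP; exact: measurableT_comp.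
  apply: emeasurable_funM => //.
  by apply/measurable_EFinP; exact: measurableT_comp.
have h0 z : (0 <= h z)%E by rewrite !mule_ge0.
have fE (g : R -> \bar R) : measurable_fun [set: R] g -> (forall x, 0 <= g x)%E ->
    (\int[gam]_x g x = \int[mu]_x (g x * (phi x)%:E))%E.
  exact: ge0_integral_normal.
have mfx x : measurable_fun [set: R] (fun y => f (x, y)).
  by apply: (measurableT_comp mf); exact: measurable_fun_pair.
transitivity (\int[gam \x gam]_z f z)%E.
  by rewrite integral_indic// setIT.
rewrite fubini_tonelli1//.
transitivity (\int[mu]_x \int[mu]_y h (x, y))%E.
  rewrite fE; last 2 first.
  - exact: (measurable_fun_fubini_tonelli_F (m2 := gam) f mf).
  - by move=> x; apply: integral_ge0 => y _; exact: f0.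
  apply: eq_integral => x _; rewrite /fubini_F fE//.
  rewrite -ge0_integralZr//.
  - by apply: emeasurable_funM; [exact: mfx|apply/measurable_EFinP].
  - by move=> y _; rewrite mule_ge0.
rewrite (integral_rotation s0 cs mh h0).
have hE u v : h (c * u - s * v, s * u + c * v) =
    ((\1_A u * phi u)%:E * (\1_B v * phi v)%:E)%E.
  rewrite /h /f /= -!EFinM; congr EFin.
  have -> : phi (s * u + c * v) = normal_peak 1 * expR (- ((s * u + c * v) ^+ 2 / 2)) by exact: phiE.
  have -> : \1_X (c * u - s * v, s * u + c * v) = \1_A u * \1_B v :> R.
    have e1 : c * (c * u - s * v) + s * (s * u + c * v) = u.
      by rewrite -[RHS]mul1r -cs; ring.
    have e2 : - s * (c * u - s * v) + c * (s * u + c * v) = v.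
      by rewrite -[RHS]mul1r -cs; ring.
    rewrite !indicE -natrM mulnb; congr (nat_of_bool _)%:R.
    by apply/idP/andP; rewrite !inE /X /= e1 e2.
  rewrite !phiE.
  rewrite -mulrA [normal_peak 1 * expR _ * (_ * expR _)]mulrACA -expRD.
  rewrite [RHS]mulrACA; congr (_ * _); rewrite mulrACA -expRD; congr (_ * expR _).
  have -> : u ^+ 2 = (c ^+ 2 + s ^+ 2) * u ^+ 2 by rewrite cs mul1r.
  have -> : v ^+ 2 = (c ^+ 2 + s ^+ 2) * v ^+ 2 by rewrite cs mul1r.
  by field.
under eq_integral do under eq_integral do rewrite hE.
have gE A' : measurable A' -> gam A' = (\int[mu]_x (\1_A' x * phi x)%:E)%E.
  move=> mA'; transitivity (\int[gam]_x (\1_A' x)%:E)%E.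
    by rewrite integral_indic// setIT.
  by rewrite fE//; apply/measurable_EFinP; exact: measurable_indic.
have mAp A' : measurable A' -> measurable_fun [set: R] (fun x => (\1_A' x * phi x)%:E).
  by move=> mA'; apply/measurable_EFinP; apply: measurable_funM => //; exact: measurable_indic.
have Ap0 A' x : (0 <= (\1_A' x * phi x)%:E)%E.
  by rewrite lee_fin mulr_ge0// normal_pdf_ge0.
have inner u : (\int[mu]_v ((\1_A u * phi u)%:E * (\1_B v * phi v)%:E) =
    (\1_A u * phi u)%:E * gam B)%E.
  rewrite ge0_integralZl//; first by rewrite -gE.
  exact: (mAp B mB).
under eq_integral do rewrite inner.
rewrite ge0_integralZr//.
- by rewrite -gE.
- exact: (mAp A mA).
Qed.
End plane_rotation.

Section iid_rotation.
Context {R : realType} d {T : measurableType d} (P : probability T R).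
Notation gam := (@normal_prob R 0 1).

(** Real-valued, so that finite products of these probabilities are real products. *)
Definition gauss (A : set R) : R := fine (gam A).

Lemma gaussE A : measurable A -> gam A = (gauss A)%:E.
Proof. by move=> mA; rewrite /gauss fineK// fin_num_measure. Qed.

Lemma gaussT : gauss setT = 1.
Proof. by rewrite /gauss probability_setT. Qed.

Lemma gauss_opp (A : set R) : measurable A -> gauss (-%R @^-1` A) = gauss A.
Proof.
move=> mA; have mN : measurable (-%R @^-1` A : set R).
  by rewrite -[X in measurable X]setTI; exact: oppr_measurable.
apply/EFin_inj; rewrite -!gaussE//.
have H B : measurable B -> gam B = (\int[gam]_x (\1_B x)%:E)%E.
  by move=> mB; rewrite integral_indic// setIT.
rewrite !H// [RHS]ge0_integral_gauss_sym//.
by apply/measurable_EFinP; exact: measurable_indic.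
Qed.

(** Independence and the laws of the coordinates in one product rule over all
    indices; a subfamily is reached by taking A i = setT elsewhere. *)
Definition iid_gauss n (Z : 'I_n -> T -> R) : Prop :=
  (forall i, measurable_fun setT (Z i)) /\
  forall A : 'I_n -> set R, (forall i, measurable (A i)) ->
    P [set w | forall i, A i (Z i w)] = (\prod_i gauss (A i))%:E.

Definition rotate n (i j : 'I_n) (c s : R) (u : 'I_n -> R) : 'I_n -> R :=
  fun l => if l == i then c * u i + s * u j
           else if l == j then - s * u i + c * u j else u l.

Lemma measurable_all n (Z : 'I_n -> T -> R) (A : 'I_n -> set R) (Q : pred 'I_n) :
  (forall i, measurable_fun setT (Z i)) -> (forall i, measurable (A i)) ->
  measurable [set w | forall i, Q i -> A i (Z i w)].
Proof.
move=> mZ mA.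
rewrite (_ : [set w | _] = \bigcap_(i in [set i | Q i]) (Z i @^-1` A i))//.
apply: fin_bigcap_measurable => // i _.
by rewrite -[X in measurable X]setTI; exact: mZ.
Qed.

(** Let E be the event that constrains the other coordinates, of probability K.
    On E, the law of the pair (Z i, Z j) is K times the product of two standard
    normal laws because it is so on rectangles; gauss_rotation applies to it. *)
Lemma iid_gauss_rotate n (Z : 'I_n -> T -> R) i j c s : i != j ->
  s != 0 -> c ^+ 2 + s ^+ 2 = 1 -> iid_gauss Z ->
  iid_gauss (fun l w => rotate i j c s (Z ^~ w) l).
Proof.
move=> ij s0 cs [mZ iZ]; split => [l|A mA].
  rewrite /rotate; case: eqP => _; last case: eqP => _ //.
    by apply: measurable_funD; exact: measurable_funM.
  by apply: measurable_funD; exact: measurable_funM.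
pose Q := [pred l : 'I_n | (l != i) && (l != j)].
pose E := [set w | forall l, Q l -> A l (Z l w)].
have mE : measurable E by exact: measurable_all.
pose pair (w : T) : measurableTypeR R * measurableTypeR R := (Z i w, Z j w).
have mpair : measurable_fun setT pair by apply: measurable_fun_pair; exact: mZ.
pose K := \prod_(l | Q l) gauss (A l).
pose X := [set z : R * R | A i (c * z.1 + s * z.2) /\ A j (- s * z.1 + c * z.2)].
have splitprod (F : 'I_n -> R) : \prod_l F l = F i * (F j * \prod_(l | Q l) F l).
  by rewrite (bigD1 i)//= (bigD1 j)/= 1?eq_sym//.
have rect (B C : set R) : measurable B -> measurable C ->
    P (E `&` pair @^-1` (B `*` C)) = (gauss B * gauss C * K)%:E.
  move=> mB mC; pose A' l := if l == i then B else if l == j then C else A l.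
  have := iZ A'; rewrite splitprod (_ : [set w | _] = E `&` pair @^-1` (B `*` C)).
    move=> ->; last first.
      by move=> l; rewrite /A'; case: eqP => // _; case: eqP.
    rewrite /A' eqxx [j == i]eq_sym (negbTE ij) eqxx mulrA; congr (_ * _)%:E.
    by apply: eq_bigr => l /andP[/negbTE-> /negbTE->].
  apply/seteqP; split => w /=.
    move=> H; split.
      by move=> l /andP[li lj]; have := H l; rewrite /A' (negbTE li) (negbTE lj).
    split; first by have := H i; rewrite /A' eqxx.
    by have := H j; rewrite /A' eqxx eq_sym (negbTE ij).
  move=> [EQ [Bw Cw]] l; rewrite /A'; case: eqP => [->//|/eqP li].
  case: eqP => [->//|/eqP lj]; apply: EQ.
  by rewrite /Q /= li lj.
have PE : P E = K%:E.
  have := rect setT setT measurableT measurableT.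
  by rewrite setXTT preimage_setT setIT gaussT !mul1r.
have mX : measurable X.
  have m1 : measurable_fun [set: R * R] (fun z : R * R => z.1) by exact: measurable_fst.
  have m2 : measurable_fun [set: R * R] (fun z : R * R => z.2) by exact: measurable_snd.
  rewrite (_ : X = (fun z : R * R => c * z.1 + s * z.2) @^-1` A i `&`
                   (fun z : R * R => - s * z.1 + c * z.2) @^-1` A j) //.
  apply: measurableI; rewrite -[Y in measurable Y]setTI.
    by apply: (measurable_funD _ _) => //; exact: measurable_funM.
  by apply: (measurable_funD _ _) => //; exact: measurable_funM.
have -> : [set w | forall l, A l (rotate i j c s (Z ^~ w) l)] = E `&` pair @^-1` X.
  apply/seteqP; split => w /=.
    move=> H; split.
      by move=> l /andP[li lj]; have := H l; rewrite /rotate (negbTE li) (negbTE lj).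
    split; first by have := H i; rewrite /rotate eqxx.
    by have := H j; rewrite /rotate eqxx eq_sym (negbTE ij).
  move=> [EQ [Bw Cw]] l; rewrite /rotate; case: eqP => [->//|/eqP li].
  case: eqP => [->//|/eqP lj]; apply: EQ.
  by rewrite /Q /= li lj.
rewrite splitprod mulrA -/K.
have K0 : 0 <= K by apply: prodr_ge0 => l _; rewrite fine_ge0.
(* The uniqueness of product measures needs a normalized law. *)
have [Keq|Kne] := eqVneq K 0.
  rewrite Keq mulr0; apply/eqP; rewrite eq_le measure_ge0 andbT -Keq -PE.
  apply: le_measure; rewrite ?inE//.
  by apply: measurableI => //; rewrite -[Y in measurable Y]setTI; exact: mpair.
have Ki0 : 0 <= K^-1 by rewrite invr_ge0.
pose m' := mscale (NngNum Ki0) (image_measure (mrestr P mE) mpair).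
have m'E Y : m' Y = (K^-1%:E * P (E `&` pair @^-1` Y))%E.
  by rewrite setIC.
have H : (gam \x gam)%E X = m' X.
  apply: (@product_measure_unique _ _ _ _ _ gam gam m') => // B C mB mC.
  rewrite [LHS](m'E (B `*` C)) rect// -!EFinM.
  transitivity ((gauss B * gauss C)%:E); first by congr EFin; field.
  by rewrite EFinM -!gaussE.
have H' : (K^-1%:E * P (E `&` pair @^-1` X))%E = (gauss (A i) * gauss (A j))%:E.
  rewrite -m'E -H EFinM -(gaussE (mA i)) -(gaussE (mA j)).
  exact: (gauss_rotation s0 cs (mA i) (mA j)).
by rewrite mulrC EFinM -H' muleA -EFinM divff// mul1e.
Qed.

End iid_rotation.

Section orthonormal_forms.
Context {R : realType} d {T : measurableType d} (P : probability T R).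
Notation gam := (@normal_prob R 0 1).

Definition fdot n (u v : 'I_n -> R) : R := \sum_l u l * v l.

Lemma fdot_rotate n (i j : 'I_n) c s u v : i != j -> c ^+ 2 + s ^+ 2 = 1 ->
  fdot (rotate i j c s u) (rotate i j c s v) = fdot u v.
Proof.
move=> ij cs; rewrite /fdot (bigD1 i)//= (bigD1 j)/= 1?eq_sym//.
rewrite [RHS](bigD1 i)//= [in RHS](bigD1 j)/= 1?eq_sym//.
rewrite /rotate !eqxx [j == i]eq_sym (negbTE ij) !addrA; congr (_ + _).
  rewrite [RHS](_ : _ = (c ^+ 2 + s ^+ 2) * (u i * v i + u j * v j)); first by ring.
  by rewrite cs mul1r.
by apply: eq_bigr => l /andP[/negbTE-> /negbTE->].
Qed.

Definition fsupp n (u : 'I_n -> R) : {set 'I_n} := [set l | u l != 0]%SET.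

(** As long as a has two nonzero entries, a rotation of these two coordinates
    sends one of them to 0, whence an induction on the support. The accumulated
    map rho preserves dot products, and fixes the vectors whose support is
    disjoint from that of a because it only rotates coordinates in the support
    of a. The latter property allows a second application of the lemma to
    another vector without disturbing the first one. *)
Lemma gauss_concentrate n (Z : 'I_n -> T -> R) (a : 'I_n -> R) : iid_gauss P Z ->
  exists (Z' : 'I_n -> T -> R) (rho : ('I_n -> R) -> 'I_n -> R),
  [/\ iid_gauss P Z', forall u v, fdot (rho u) (rho v) = fdot u v,
      forall w, Z' ^~ w = rho (Z ^~ w), (#|fsupp (rho a)| <= 1)%N &
      forall u, (forall l, a l * u l = 0) -> rho u = u].
Proof.
have [N] := ubnP #|fsupp a|; elim: N => // N IH in Z a * => aN iZ.
have [a1|] := leqP #|fsupp a| 1; first by exists Z, id; split.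
move=> /card_gt1P[i [j [+ + ij]]]; rewrite !inE => ai aj.
pose r := Num.sqrt (a i ^+ 2 + a j ^+ 2).
have r2 : r ^+ 2 = a i ^+ 2 + a j ^+ 2 by rewrite sqr_sqrtr// addr_ge0// sqr_ge0.
have r0 : r != 0.
  rewrite -(sqrf_eq0 r) r2 paddr_eq0 ?sqr_ge0// negb_and.
  by rewrite sqrf_eq0 ai.
pose c := a i / r; pose s := a j / r.
have s0 : s != 0 by rewrite mulf_neq0// invr_eq0.
have cs : c ^+ 2 + s ^+ 2 = 1.
  by rewrite !exprMn -mulrDl -r2 -exprMn divff// expr1n.
pose ro := rotate i j c s.
have roj : ro a j = 0.
  by rewrite /ro /rotate eqxx eq_sym (negbTE ij) /c /s; ring.
have roai l : l != i -> l != j -> ro a l = a l.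
  by move=> /negbTE li /negbTE lj; rewrite /ro /rotate li lj.
have sub : fsupp (ro a) \subset fsupp a :\ j.
  apply/fintype.subsetP => l; rewrite !inE; have [->|lj] := eqVneq l j.
    by rewrite roj eqxx.
  by have [->//|li] := eqVneq l i; rewrite roai.
have cN : (#|fsupp (ro a)| < N)%N.
  rewrite (leq_ltn_trans (subset_leq_card sub))//.
  by move: aN; rewrite (cardsD1 j) inE aj.
have iZ1 := iid_gauss_rotate ij s0 cs iZ.
have [Z' [rho [iZ' rhodot Z'E sup fix_]]] := IH _ _ cN iZ1.
exists Z', (rho \o ro); split => //.
- by move=> u v /=; rewrite rhodot fdot_rotate.
- move=> u au.
  have u0 l : a l != 0 -> u l = 0.
    by move=> al; have /eqP := au l; rewrite mulf_eq0 (negbTE al) => /eqP.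
  have rou : ro u = u.
    apply/funext => l; rewrite /ro /rotate (u0 i)// (u0 j)// !mulr0 addr0.
    by case: eqP => [->|_]; [rewrite u0|case: eqP => [->|//]; rewrite u0].
  rewrite /= rou fix_// => l.
  have [->|lj] := eqVneq l j; first by rewrite roj mul0r.
  have [->|li] := eqVneq l i; first by rewrite u0// mulr0.
  by rewrite roai.
Qed.

Lemma supp_unit n (a : 'I_n -> R) : (#|fsupp a| <= 1)%N -> fdot a a = 1 ->
  exists i e, [/\ forall v, fdot a v = e * v i, e = 1 \/ e = -1 & a i = e].
Proof.
move=> a1 aa.
have [i ai] : exists i, a i != 0.
  apply/existsP; apply: contraT; rewrite negb_exists => /forallP a0.
  move: aa; rewrite /fdot big1 => [/eqP|l _].
    by rewrite eq_sym oner_eq0.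
  by have := a0 l; rewrite negbK => /eqP ->; rewrite mul0r.
have al l : l != i -> a l = 0.
  move=> li; apply/eqP; apply: contraLR a1 => nz; rewrite -ltnNge.
  apply/card_gt1P; exists l, i; split => //; rewrite inE//.
have H v : fdot a v = a i * v i.
  by rewrite /fdot (bigD1 i)//= big1 ?addr0// => l li; rewrite al// mul0r.
exists i, (a i); split => //.
move: aa; rewrite H -expr2 => /eqP.
by rewrite sqrf_eq1 => /orP[] /eqP ->; [left|right].
Qed.

Lemma gauss_sign (e : R) (A : set R) : e = 1 \/ e = -1 -> measurable A ->
  measurable ((fun x : R => e * x) @^-1` A) /\ gauss ((fun x : R => e * x) @^-1` A) = gauss A.
Proof.
move=> He mA; split.
  by rewrite -[X in measurable X]setTI; exact: measurable_funM.
case: He => ->.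
  by congr gauss; apply/seteqP; split => x /=; rewrite mul1r.
rewrite -[RHS]gauss_opp//.
by congr gauss; apply/seteqP; split => x /=; rewrite mulN1r.
Qed.

Lemma gauss_lin1 n (Z : 'I_n -> T -> R) (a : 'I_n -> R) (A : set R) :
  iid_gauss P Z -> fdot a a = 1 -> measurable A ->
  P [set w | A (fdot a (Z ^~ w))] = (gauss A)%:E.
Proof.
move=> iZ aa mA; have [Z' [rho [iZ' rd Z'E sup _]]] := gauss_concentrate a iZ.
have [|i [e [aE He _]]] := supp_unit sup; first by rewrite rd.
have [mA' <-] := gauss_sign He mA.
pose A' l := if l == i then (fun x : R => e * x) @^-1` A else setT.
rewrite (_ : [set w | _] = [set w | forall l, A' l (Z' l w)]).
  rewrite (proj2 iZ'); last by move=> l; rewrite /A'; case: eqP.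
  rewrite (bigD1 i)//= big1 ?mulr1 => [|l /negbTE li].
    by rewrite /A' eqxx.
  by rewrite /A' li gaussT.
have dE w : fdot a (Z ^~ w) = e * Z' i w.
  by rewrite -(aE (Z' ^~ w)) Z'E rd.
apply/seteqP; split => w /=; rewrite dE.
  by move=> H l; rewrite /A'; case: eqP => [->|].
by move/(_ i); rewrite /A' eqxx.
Qed.

(** Concentrate a on a coordinate i, then b. After the first step b vanishes at
    i by orthogonality, so the second step leaves a alone, and concentrates b on
    a coordinate that differs from i. The two forms have become two coordinates,
    up to signs. *)
Lemma gauss_lin2 n (Z : 'I_n -> T -> R) (a b : 'I_n -> R) (A B : set R) :
  iid_gauss P Z -> fdot a a = 1 -> fdot b b = 1 -> fdot a b = 0 ->
  measurable A -> measurable B ->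
  P [set w | A (fdot a (Z ^~ w)) /\ B (fdot b (Z ^~ w))] = (gauss A * gauss B)%:E.
Proof.
move=> iZ aa bb ab mA mB.
have [Z1 [rho1 [iZ1 rd1 Z1E sup1 _]]] := gauss_concentrate a iZ.
have [Z2 [rho2 [iZ2 rd2 Z2E sup2 fix2]]] := gauss_concentrate (rho1 b) iZ1.
have [|i [e [aE He ei]]] := supp_unit sup1; first by rewrite rd1.
have [|j [f [bE Hf fj]]] := supp_unit sup2; first by rewrite rd2 rd1.
have e0 : e != 0 by case: He => ->; rewrite ?oppr_eq0 oner_neq0.
have f0 : f != 0 by case: Hf => ->; rewrite ?oppr_eq0 oner_neq0.
have b0 : rho1 b i = 0.
  have : fdot (rho1 a) (rho1 b) = 0 by rewrite rd1.
  by rewrite aE => /eqP; rewrite mulf_eq0 (negbTE e0) => /eqP.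
have a0 l : l != i -> rho1 a l = 0.
  move=> li; apply/eqP; apply: contraLR sup1 => nz; rewrite -ltnNge.
  by apply/card_gt1P; exists l, i; split => //; rewrite inE// ei.
have ra : rho2 (rho1 a) = rho1 a.
  apply: fix2 => l; have [->|li] := eqVneq l i; first by rewrite b0 mul0r.
  by rewrite a0// mulr0.
have ij : i != j.
  apply/eqP => ijE.
  have : fdot (rho2 (rho1 b)) (rho2 (rho1 a)) = 0.
    by rewrite rd2 rd1 /fdot; under eq_bigr do rewrite mulrC.
  rewrite ra bE -ijE ei => /eqP; rewrite mulf_eq0 (negbTE e0) (negbTE f0).
  by [].
have [mA' <-] := gauss_sign He mA.
have [mB' <-] := gauss_sign Hf mB.
pose A' l := if l == i then (fun x : R => e * x) @^-1` A
             else if l == j then (fun x : R => f * x) @^-1` B else setT.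
rewrite (_ : [set w | _] = [set w | forall l, A' l (Z2 l w)]).
  rewrite (proj2 iZ2); last by move=> l; rewrite /A'; case: eqP => // _; case: eqP.
  rewrite (bigD1 i)//= (bigD1 j)/= 1?eq_sym// big1 ?mulr1 => [|l /andP[/negbTE li /negbTE lj]].
    by rewrite /A' eqxx [j == i]eq_sym (negbTE ij) eqxx.
  by rewrite /A' li lj gaussT.
have dEa w : fdot a (Z ^~ w) = e * Z2 i w.
  by rewrite -(aE (Z2 ^~ w)) -ra Z2E Z1E rd2 rd1.
have dEb w : fdot b (Z ^~ w) = f * Z2 j w.
  by rewrite -(bE (Z2 ^~ w)) Z2E Z1E rd2 rd1.
apply/seteqP; split => w /=; rewrite dEa dEb.
  move=> [HA HB] l; rewrite /A'; case: eqP => [->|]//.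
  by case: eqP => [->|].
move=> H; split; first by have := H i; rewrite /A' eqxx.
by have := H j; rewrite /A' eq_sym (negbTE ij) eqxx.
Qed.

End orthonormal_forms.

(** * Sums over pairwise independent standard normal variables *)

(** The integral of a nonnegative function is a supremum over the simple
    functions below it, hence is monotone. This transfers pointwise bounds
    on the loss of the estimator to its risk. *)
Lemma le_integral_ge0 d (T : measurableType d) (R : realType)
    (m : {measure set T -> \bar R}) (f g : T -> \bar R) :
  (forall x, 0 <= f x)%E -> (forall x, f x <= g x)%E ->
  (\int[m]_x f x <= \int[m]_x g x)%E.
Proof.
move=> f0 fg; have g0 x : (0 <= g x)%E by exact: le_trans (fg x).
rewrite !ge0_integralTE//; apply: ereal_sup_le => _ [h hf <-].
by exists h => // x; exact: le_trans (hf x) (fg x).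
Qed.

Section pairwise_gaussian.
Context {R : realType} d {T : measurableType d} (P : probability T R).
Notation gam := (@normal_prob R 0 1).

(** The bounds below use the joint law only through variances of sums, hence
    independence in pairs. *)
Definition pairwise_gauss p (G : 'I_p -> T -> R) : Prop :=
  [/\ forall j, measurable_fun setT (G j),
      forall j (A : set R), measurable A -> P (G j @^-1` A) = gam A &
      forall j l (A B : set R), j != l -> measurable A -> measurable B ->
        P (G j @^-1` A `&` G l @^-1` B) = (gam A * gam B)%E].

Lemma integral_coordinate p (G : 'I_p -> T -> R) j (f : R -> \bar R) : pairwise_gauss G ->
  measurable_fun [set: R] f -> (forall x, 0 <= f x)%E ->
  (\int[P]_w f (G j w) = \int[gam]_x f x)%E.
Proof.
move=> [mG G1 _] mf f0.
have mGj : measurable_fun setT (G j : T -> measurableTypeR R) by exact: mG.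
rewrite (eq_measure_integral (image_measure P mGj)); last first.
  by move=> A mA _; exact: esym (G1 j A mA).
by rewrite ge0_integral_pushforward.
Qed.

Lemma integral_two_coordinates p (G : 'I_p -> T -> R) j l (f g : R -> \bar R) : pairwise_gauss G ->
  j != l ->
  measurable_fun [set: R] f -> (forall x, 0 <= f x)%E ->
  measurable_fun [set: R] g -> (forall x, 0 <= g x)%E ->
  (\int[P]_w (f (G j w) * g (G l w)) = \int[gam]_x f x * \int[gam]_x g x)%E.
Proof.
move=> [mG _ G2] jl mf f0 mg g0.
pose pair w : measurableTypeR R * measurableTypeR R := (G j w, G l w).
have mpair : measurable_fun setT pair by apply: measurable_fun_pair; exact: mG.
pose h (z : R * R) := (f z.1 * g z.2)%E.
have mh : measurable_fun [set: R * R] h.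
  by apply: emeasurable_funM; [apply: (measurableT_comp mf); exact: measurable_fst|
    apply: (measurableT_comp mg); exact: measurable_snd].
have h0 z : (0 <= h z)%E by rewrite mule_ge0.
transitivity (\int[image_measure P mpair]_z h z)%E.
  by rewrite ge0_integral_pushforward.
transitivity (\int[gam \x gam]_z h z)%E.
  apply: eq_measure_integral => A mA _.
  apply/esym; apply: (@product_measure_unique _ _ _ _ _ gam gam (image_measure P mpair)) => //.
  by move=> B C mB mC; exact: G2.
rewrite fubini_tonelli1//.
transitivity (\int[gam]_x (f x * \int[gam]_y g y))%E.
  by apply: eq_integral => x _; rewrite /fubini_F /h/= ge0_integralZl//.
rewrite ge0_integralZr//.
by apply: integral_ge0.
Qed.

(** The centered square is expanded as an identity between nonnegative
    functions, W^2 + m^2 = (W - m)^2 + 2 m W, so that integrals add up. By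
    pairwise independence the second moment of W is at most p b + m^2. *)
Lemma variance_sum_le p (G : 'I_p -> T -> R) (w : R -> R) (a b : R) :
  pairwise_gauss G -> measurable_fun [set: R] w -> (forall x, 0 <= w x) ->
  (\int[gam]_x (w x)%:E = a%:E)%E -> (\int[gam]_x (w x ^+ 2)%:E <= b%:E)%E ->
  (\int[P]_t ((\sum_j w (G j t) - p%:R * a) ^+ 2)%:E <= (p%:R * b)%:E)%E.
Proof.
move=> pG mw w0 wa wb.
have [mG _ _] := pG.
have a0 : 0 <= a by rewrite -lee_fin -wa; apply: integral_ge0 => x _; rewrite lee_fin.
have b0 : 0 <= b.
  by rewrite -lee_fin (le_trans _ wb)//; apply: integral_ge0 => x _; rewrite lee_fin sqr_ge0.
pose m := p%:R * a; pose W t := \sum_j w (G j t).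
have m0 : 0 <= m by rewrite mulr_ge0.
have mwG j : measurable_fun setT (fun t => w (G j t)) by exact: measurableT_comp.
have mW : measurable_fun setT W by apply: measurable_sum.
have W0 t : 0 <= W t by apply: sumr_ge0.
have mwE : measurable_fun [set: R] (fun x => (w x)%:E) by exact/measurable_EFinP.
have mw2E : measurable_fun [set: R] (fun x => (w x ^+ 2)%:E).
  by apply/measurable_EFinP; exact: measurable_funX.
have EW : (\int[P]_t (W t)%:E = m%:E)%E.
  rewrite /W; under eq_integral do rewrite -sumEFin.
  rewrite ge0_integral_sum//.
  - rewrite (eq_bigr (fun=> a%:E)) => [|j _].
      by rewrite sumEFin sumr_const card_ord /m mulr_natl.
    by rewrite (integral_coordinate _ pG mwE).
  - by move=> j; exact/measurable_EFinP.
  - by move=> j t _; rewrite lee_fin.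
pose b' := fine (\int[gam]_x (w x ^+ 2)%:E)%E.
have b'E : (\int[gam]_x (w x ^+ 2)%:E = b'%:E)%E.
  rewrite /b' fineK// ge0_fin_numE; first exact: le_lt_trans wb (ltry _).
  by apply: integral_ge0 => x _; rewrite lee_fin sqr_ge0.
have b'b : b' <= b by rewrite -lee_fin -b'E.
have EW2 : (\int[P]_t (W t ^+ 2)%:E <= (p%:R * b + m ^+ 2)%:E)%E.
  have W2 t : (W t ^+ 2)%:E = (\sum_j \sum_l (w (G j t) * w (G l t))%:E)%E.
    rewrite expr2 /W mulr_suml -sumEFin; apply: eq_bigr => j _.
    by rewrite mulr_sumr -sumEFin.
  under eq_integral do rewrite W2.
  rewrite ge0_integral_sum//; last 2 first.
  - move=> j; apply: emeasurable_sum => l; apply/measurable_EFinP.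
    exact: measurable_funM.
  - by move=> j t _; apply: sume_ge0 => l _; rewrite lee_fin mulr_ge0.
  apply: (@le_trans _ _ (\sum_(j < p) (b + p%:R * a ^+ 2)%:E)%E); last first.
    rewrite sumEFin sumr_const card_ord lee_fin -[leLHS]mulr_natl /m.
    by rewrite le_eqVlt; apply/orP; left; apply/eqP; ring.
  apply: lee_sum => j _.
  rewrite ge0_integral_sum//; last 2 first.
  - by move=> l; apply/measurable_EFinP; exact: measurable_funM.
  - by move=> l t _; rewrite lee_fin mulr_ge0.
  rewrite (bigD1 j)//= EFinD; apply: leeD.
    have := @integral_coordinate _ _ j _ pG mw2E; rewrite b'E => H.
    under eq_integral do rewrite -expr2.
    by rewrite H ?lee_fin// => x; rewrite lee_fin sqr_ge0.
  apply: (@le_trans _ _ (\sum_(l < p | l != j) (a ^+ 2)%:E)%E).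
    apply: lee_sum => l lj; under eq_integral do rewrite EFinM.
    by rewrite (integral_two_coordinates pG _ mwE _ mwE)// 1?eq_sym// wa -EFinM expr2.
  rewrite sumEFin lee_fin sumr_const -[leLHS]mulr_natl ler_wpM2r ?sqr_ge0// ler_nat.
  by rewrite -[leqRHS](card_ord p) max_card.
have sq0 t : (0 <= ((W t - m) ^+ 2)%:E)%E by rewrite lee_fin sqr_ge0.
have msq : measurable_fun setT (fun t => ((W t - m) ^+ 2)%:E).
  by apply/measurable_EFinP; apply: measurable_funX; exact: measurable_funB.
have key : (\int[P]_t ((W t - m) ^+ 2)%:E + (2 * m ^+ 2)%:E =
    \int[P]_t (W t ^+ 2)%:E + (m ^+ 2)%:E)%E.
  have -> : ((2 * m ^+ 2)%:E = \int[P]_t ((2 * m)%:E * (W t)%:E))%E.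
    rewrite ge0_integralZl//; last 3 first.
    - exact/measurable_EFinP.
    - by move=> t _; rewrite lee_fin.
    - by rewrite lee_fin mulr_ge0.
    by rewrite EW -EFinM; congr EFin; ring.
  have -> : ((m ^+ 2)%:E = \int[P]_t (cst (m ^+ 2)%:E t))%E.
    rewrite integral_cst//=.
    by rewrite probability_setT mule1.
  rewrite -!ge0_integralD//.
  - apply: eq_integral => t _; rewrite /cst -!EFinM -!EFinD; congr EFin; ring.
  - by move=> t _; rewrite lee_fin sqr_ge0.
  - by apply/measurable_EFinP; exact: measurable_funX.
  - by move=> t _; rewrite lee_fin sqr_ge0.
  - by move=> t _; rewrite -EFinM lee_fin !mulr_ge0.
  - by apply: emeasurable_funM => //; exact/measurable_EFinP.
have : (\int[P]_t ((W t - m) ^+ 2)%:E + (2 * m ^+ 2)%:E <=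
    (p%:R * b)%:E + (2 * m ^+ 2)%:E)%E.
  rewrite key; apply: le_trans (leeD2r _ EW2) _.
  by rewrite -!EFinD lee_fin; lra.
by rewrite leeD2rE.
Qed.

End pairwise_gaussian.

(** * Order statistics of Gaussian noise *)

Section crossing_moments.
Context {R : realType} d {T : measurableType d} (P : probability T R).
Notation gam := (@normal_prob R 0 1).

(** A coordinate of size above tau counts for 1 plus e tau times its excess. The
    second term makes a sum of such counts control not only the number of
    crossings of tau, but also how far they go. *)
Definition crossing (tau e x : R) : R := (tau < `|x|)%R%:R + e * tau * excess tau x.

Lemma crossing_ge0 tau e x : 0 <= tau -> 0 <= e -> 0 <= crossing tau e x.
Proof. by move=> t0 e0; rewrite addr_ge0// !mulr_ge0// excess_ge0. Qed.

Lemma measurable_absgt tau : measurable [set x : R | tau < `|x|].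
Proof.
rewrite (_ : [set x | _] = (fun x : R => `|x|) @^-1` `]tau, +oo[); last first.
  by apply/seteqP; split => x /=; rewrite in_itv/= andbT.
by rewrite -[X in measurable X]setTI; exact: normr_measurable.
Qed.

Lemma indic_absgt tau : (fun x : R => (tau < `|x|)%R%:R) = \1_[set x : R | tau < `|x|] :> (R -> R).
Proof. by apply/funext => x; rewrite indicE; congr (nat_of_bool _)%:R; apply/idP/idP; rewrite inE. Qed.

Lemma measurable_crossing tau e : measurable_fun [set: R] (crossing tau e).
Proof.
apply: measurable_funD; last first.
  by apply: measurable_funM => //; exact: measurable_excess.
by rewrite indic_absgt; apply: measurable_indic; exact: measurable_absgt.
Qed.

Lemma integral_absgt tau : 0 <= tau -> (\int[gam]_x ((tau < `|x|)%R%:R)%:E = (tail tau)%:E)%E.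
Proof.
move=> t0; rewrite -tail_prob//.
transitivity (\int[gam]_x (\1_[set x : R | tau < `|x|] x)%:E)%E.
  by rewrite -indic_absgt.
by rewrite integral_indic ?setIT//; exact: measurable_absgt.
Qed.

Lemma tail_ge0 (t : R) : 0 <= tail t.
Proof.
by rewrite mulr_ge0// subr_ge0 -lee_fin Phi_fin probability_le1.
Qed.

Lemma crossing_mean tau e : 0 < tau -> 0 < e ->
  (\int[gam]_x (crossing tau e x)%:E <= ((1 + e) * tail tau)%:E)%E.
Proof.
move=> t0 e0; rewrite /crossing; under eq_integral do rewrite EFinD.
have mabs : measurable_fun [set: R] (fun x : R => ((tau < `|x|)%R%:R : R)%:E).
  by apply/measurable_EFinP; rewrite indic_absgt; apply: measurable_indic; exact: measurable_absgt.
have mex : measurable_fun [set: R] (fun x : R => (excess tau x)%:E).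
  by apply/measurable_EFinP; exact: measurable_excess.
have ge x : (0 <= (excess tau x)%:E)%E by rewrite lee_fin excess_ge0.
rewrite ge0_integralD//; last 2 first.
- by move=> x _; rewrite EFinM mule_ge0// lee_fin mulr_ge0 ?ltW.
- by under eq_fun do rewrite EFinM; exact: emeasurable_funM.
rewrite (integral_absgt (ltW t0)); under [X in (_ + X)%E]eq_integral do rewrite EFinM.
rewrite ge0_integralZl//; last by rewrite lee_fin mulr_ge0 ?ltW.
rewrite mulrDl mul1r EFinD.
apply: leeD2l.
apply: (@le_trans _ _ ((e * tau)%:E * (tail tau / tau)%:E)%E).
  by apply: lee_wpmul2l; [rewrite lee_fin mulr_ge0 ?ltW|exact: excess_mean_le].
by rewrite -EFinM lee_fin le_eqVlt; apply/orP; left; apply/eqP; field; rewrite gt_eqF.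
Qed.

Lemma crossing_sqr tau e : 0 < tau -> 0 < e ->
  (\int[gam]_x (crossing tau e x ^+ 2)%:E <= ((2 + 4 * e ^+ 2) * tail tau)%:E)%E.
Proof.
move=> t0 e0.
have mabs : measurable_fun [set: R] (fun x : R => ((tau < `|x|)%R%:R : R)%:E).
  by apply/measurable_EFinP; rewrite indic_absgt; apply: measurable_indic; exact: measurable_absgt.
have mex : measurable_fun [set: R] (fun x : R => (excess tau x ^+ 2)%:E).
  by apply/measurable_EFinP; apply: measurable_funX; exact: measurable_excess.
have ge x : (0 <= (excess tau x ^+ 2)%:E)%E by rewrite lee_fin sqr_ge0.
apply: (@le_trans _ _ (\int[gam]_x (2%:E * ((tau < `|x|)%R%:R)%:E +
    (2 * (e * tau) ^+ 2)%:E * (excess tau x ^+ 2)%:E))%E).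
  apply: le_integral_ge0 => x; first by rewrite lee_fin sqr_ge0.
  rewrite -!EFinM -EFinD lee_fin /crossing.
  set u : R := (_ < _)%R%:R; set v := e * tau; set z := excess _ _.
  have -> : 2 * u = 2 * u ^+ 2 by rewrite /u; case: (_ < _); rewrite ?expr0n ?expr1n.
  by have := sqr_ge0 (u - v * z); nra.
have c0 : 0 <= 2 * (e * tau) ^+ 2 by rewrite mulr_ge0// sqr_ge0.
rewrite ge0_integralD//; last 3 first.
- exact: emeasurable_funM.
- by move=> x _; rewrite mule_ge0.
- exact: emeasurable_funM.
rewrite ge0_integralZl// ge0_integralZl// (integral_absgt (ltW t0)).
have -> : (((2 + 4 * e ^+ 2) * tail tau)%:E = (2 * tail tau)%:E + (4 * e ^+ 2 * tail tau)%:E)%E.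
  by rewrite -EFinD -mulrDl.
apply: leeD; first by rewrite EFinM.
apply: (@le_trans _ _ ((2 * (e * tau) ^+ 2)%:E * (2 * tail tau / tau ^+ 2)%:E)%E).
  by apply: lee_wpmul2l; [rewrite lee_fin|exact: excess_sqr_le].
by rewrite -EFinM lee_fin le_eqVlt; apply/orP; left; apply/eqP; field; rewrite gt_eqF.
Qed.

(** If the value of rank r exceeds tau by u > 0, then r + 1 coordinates have a
    crossing count of at least 1 + e tau u. Their sum exceeds r + 1 >= m by
    (r + 1) e tau u. *)
Lemma ostat_crossing p (g : 'cV[R]_p) (r : nat) tau e m : (r < p)%N ->
  0 < tau -> 0 < e -> m <= r.+1%:R ->
  Num.max 0 (ostat g r - tau) ^+ 2 <=
    ((e * tau * r.+1%:R) ^+ 2)^-1 * (\sum_j crossing tau e (g j 0) - m) ^+ 2.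
Proof.
move=> rp t0 e0 mr; have [/eqP u0|u0] := leP (ostat g r - tau) 0.
  by rewrite expr0n mulr_ge0 ?invr_ge0 ?sqr_ge0.
set u := ostat g r - tau in u0 *.
have [s sb] := ostat_perm g; pose A := topset s r.+1.
have HA j : j \in A -> 1 + e * tau * u <= crossing tau e (g j 0).
  rewrite -[j](permKV s) mem_topset ltnS => jr.
  have H : ostat g r <= `|g (s (s^-1%g j)) 0| by rewrite -sb ostat_mono.
  have tH : tau < ostat g r by rewrite -subr_gt0.
  rewrite /crossing (lt_le_trans tH H) lerD2l; apply: ler_wpM2l.
    by rewrite mulr_ge0 ?ltW.
  by rewrite /excess le_max lerD2r H orbT.
have sumA : r.+1%:R * (1 + e * tau * u) <= \sum_j crossing tau e (g j 0).
  apply: (@le_trans _ _ (\sum_(j in A) (1 + e * tau * u))).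
    by rewrite sumr_const card_topset// mulr_natl.
  rewrite [leRHS](bigID (mem A)) /= -[leLHS]addr0; apply: lerD; first exact: ler_sum.
  by apply: sumr_ge0 => j _; rewrite crossing_ge0 ?ltW.
have K0 : 0 < e * tau * r.+1%:R by rewrite !mulr_gt0.
have Ku : 0 <= u * (e * tau * r.+1%:R) by rewrite mulr_ge0 ?ltW.
have key : u * (e * tau * r.+1%:R) <= \sum_j crossing tau e (g j 0) - m.
  by move: sumA mr; set S := \sum_j _; set N := r.+1%:R; lra.
rewrite mulrC ler_pdivlMr ?exprn_gt0// -exprMn.
by rewrite ler_pXn2r ?nnegrE// (le_trans Ku).
Qed.

End crossing_moments.

Section rank_bounds.
Context {R : realType} d {T : measurableType d} (P : probability T R).
Notation gam := (@normal_prob R 0 1).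

Definition mean_crossing (tau e : R) : R := fine (\int[gam]_x (crossing tau e x)%:E)%E.

Lemma mean_crossingE tau e : 0 < tau -> 0 < e ->
  (\int[gam]_x (crossing tau e x)%:E = (mean_crossing tau e)%:E)%E.
Proof.
move=> t0 e0; rewrite /mean_crossing fineK// ge0_fin_numE.
  by apply: le_lt_trans (crossing_mean t0 e0) (ltry _).
by apply: integral_ge0 => x _; rewrite lee_fin crossing_ge0 ?ltW.
Qed.

(** The centered sum of ostat_crossing, whose expectation variance_sum_le
    bounds. *)
Definition rank_bound p (G : 'I_p -> T -> R) tau e r w : R :=
  ((e * tau * r.+1%:R) ^+ 2)^-1 *
  (\sum_j crossing tau e (G j w) - p%:R * mean_crossing tau e) ^+ 2.

Lemma rank_bound_ge0 p (G : 'I_p -> T -> R) tau e r w : 0 <= rank_bound G tau e r w.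
Proof. by rewrite mulr_ge0 ?invr_ge0 ?sqr_ge0. Qed.

Lemma measurable_rank_bound p (G : 'I_p -> T -> R) tau e r : pairwise_gauss P G ->
  measurable_fun setT (rank_bound G tau e r).
Proof.
move=> [mG _ _]; apply: measurable_funM => //; apply: measurable_funX.
apply: measurable_funB => //; apply: measurable_sum => j.
by apply: measurableT_comp => //; exact: measurable_crossing.
Qed.

Lemma rank_bound_ostat p (G : 'I_p -> T -> R) (r : nat) tau e w : (r < p)%N ->
  0 < tau -> 0 < e -> p%:R * tail tau * (1 + e) <= r.+1%:R ->
  Num.max 0 (ostat (\col_j G j w) r - tau) ^+ 2 <= rank_bound G tau e r w.
Proof.
move=> rp t0 e0 H; apply: le_trans.
  apply: (@ostat_crossing _ _ _ _ _ e (p%:R * mean_crossing tau e)) => //.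
  apply: le_trans H; rewrite -mulrA ler_wpM2l// mulrC.
  by rewrite -lee_fin -mean_crossingE//; exact: crossing_mean.
rewrite /rank_bound le_eqVlt; apply/orP; left; apply/eqP; congr (_ * (_ - _) ^+ 2).
by apply: eq_bigr => j _; rewrite mxE.
Qed.

(** The variance is at most p times the second moment of one crossing count,
    which is O(tail tau), and p * tail tau is at most the rank by hypothesis.
    So the square of the rank in the denominator loses one power. *)
Lemma rank_bound_integral p (G : 'I_p -> T -> R) (r : nat) tau e : pairwise_gauss P G ->
  0 < tau -> 0 < e -> p%:R * tail tau * (1 + e) <= r.+1%:R ->
  (\int[P]_w (rank_bound G tau e r w)%:E <=
    ((2 + 4 * e ^+ 2) / e ^+ 2 * (r.+1%:R * tau ^+ 2)^-1)%:E)%E.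
Proof.
move=> pG t0 e0 H; pose S w := \sum_j crossing tau e (G j w) - p%:R * mean_crossing tau e.
have mS : measurable_fun setT S.
  have [mG _ _] := pG; apply: measurable_funB => //; apply: measurable_sum => j.
  by apply: measurableT_comp => //; exact: measurable_crossing.
have K0 : 0 <= ((e * tau * r.+1%:R) ^+ 2)^-1 by rewrite invr_ge0 sqr_ge0.
rewrite /rank_bound; under eq_integral do rewrite EFinM.
rewrite ge0_integralZl//; last first.
- by move=> w _; rewrite lee_fin sqr_ge0.
- by apply/measurable_EFinP; apply: measurable_funX.
apply: (@le_trans _ _ ((((e * tau * r.+1%:R) ^+ 2)^-1)%:E *
    (p%:R * ((2 + 4 * e ^+ 2) * tail tau))%:E)%E).
  apply: lee_wpmul2l; first by rewrite lee_fin.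
  apply: variance_sum_le => //.
  - exact: measurable_crossing.
  - by move=> x; rewrite crossing_ge0 ?ltW.
  - exact: mean_crossingE.
  - exact: crossing_sqr.
have N0 : 0 < r.+1%:R :> R by [].
have H' : p%:R * tail tau <= r.+1%:R.
  by apply: le_trans H; rewrite ler_peMr ?lerDl ?(ltW e0)// mulr_ge0// tail_ge0.
rewrite -EFinM lee_fin.
rewrite [leRHS](_ : _ = ((e * tau * r.+1%:R) ^+ 2)^-1 * ((2 + 4 * e ^+ 2) * r.+1%:R)).
  apply: ler_wpM2l => //; rewrite mulrCA; apply: ler_wpM2l => //.
  by rewrite addr_ge0// mulr_ge0// sqr_ge0.
by field; rewrite !gt_eqF.
Qed.

Lemma gauss_sqr_le6 p (G : 'I_p -> T -> R) j : pairwise_gauss P G ->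
  (\int[P]_w (G j w ^+ 2)%:E <= 6%:E)%E.
Proof.
move=> pG.
have m2 : measurable_fun [set: R] (fun x : R => (x ^+ 2)%:E).
  by apply/measurable_EFinP; exact: measurable_funX.
rewrite (integral_coordinate j pG m2); last by move=> x; rewrite lee_fin sqr_ge0.
have mex : measurable_fun [set: R] (fun x : R => (excess 1 x ^+ 2)%:E).
  by apply/measurable_EFinP; apply: measurable_funX; exact: measurable_excess.
apply: (@le_trans _ _ (\int[gam]_x (2%:E * (excess 1 x ^+ 2)%:E + cst 2%:E x))%E).
  apply: le_integral_ge0 => x; first by rewrite lee_fin sqr_ge0.
  rewrite -EFinM -EFinD lee_fin -(real_normK (num_real x)) /excess.
  have := normr_ge0 x; set y := `|x| => y0.
  by have [y1|y1] := leP (y - 1) 0; have := sqr_ge0 (y - 2); nra.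
rewrite ge0_integralD//; last 2 first.
- exact: emeasurable_funM.
- by move=> x _; rewrite lee_fin.
rewrite ge0_integralZl//; last by move=> x _; rewrite lee_fin sqr_ge0.
rewrite integral_cst//= probability_setT mule1.
have t1 : tail (1 : R) <= 1.
  by rewrite -lee_fin -tail_prob// probability_le1//; exact: measurable_absgt.
apply: (@le_trans _ _ (2%:E * (2 * tail 1 / 1 ^+ 2)%:E + 2%:E)%E).
  apply: leeD => //; apply: lee_wpmul2l; first by rewrite lee_fin.
  exact: excess_sqr_le.
  by rewrite -EFinM -EFinD lee_fin expr1n divr1; lra.
by move=> x _; rewrite mule_ge0// lee_fin sqr_ge0.
Qed.

Lemma excess_sum_integral p (G : 'I_p -> T -> R) tau : pairwise_gauss P G -> 0 < tau ->
  (\int[P]_w (\sum_j excess tau (G j w) ^+ 2)%:E <= (p%:R * (2 * tail tau / tau ^+ 2))%:E)%E.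
Proof.
move=> pG t0; have [mG _ _] := pG.
have mex : measurable_fun [set: R] (fun x : R => (excess tau x ^+ 2)%:E).
  by apply/measurable_EFinP; apply: measurable_funX; exact: measurable_excess.
under eq_integral do rewrite -sumEFin.
rewrite ge0_integral_sum//.
- apply: (@le_trans _ _ (\sum_(j < p) (2 * tail tau / tau ^+ 2)%:E)%E).
    apply: lee_sum => j _; rewrite (integral_coordinate j pG mex).
      exact: excess_sqr_le.
    by move=> x; rewrite lee_fin sqr_ge0.
  by rewrite sumEFin sumr_const card_ord lee_fin -[leLHS]mulr_natl.
- move=> j; apply: (measurableT_comp mex); exact: mG.
- by move=> j w _; rewrite lee_fin sqr_ge0.
Qed.

Lemma noise_sum_integral p (G : 'I_p -> T -> R) (S : {set 'I_p}) : pairwise_gauss P G ->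
  (\int[P]_w (\sum_(j in S) G j w ^+ 2)%:E <= (6 * #|S|%:R)%:E)%E.
Proof.
move=> pG; have [mG _ _] := pG.
under eq_integral do rewrite -sumEFin big_mkcond.
pose f (j : 'I_p) w : \bar R := if j \in S then (G j w ^+ 2)%:E else 0%E.
have mf j : measurable_fun setT (f j).
  rewrite /f; case: (j \in S); last exact: measurable_cst.
  by apply/measurable_EFinP; apply: measurable_funX; exact: mG.
rewrite (ge0_integral_sum _ _ (f := f))//.
- apply: (@le_trans _ _ (\sum_(j < p) (if j \in S then 6 else 0)%:E)%E).
    apply: lee_sum => j _; rewrite /f; case: ifP => _; last by rewrite integral_cst//= mul0e.
    exact: gauss_sqr_le6.
  by rewrite sumEFin -big_mkcond/= sumr_const mulr_natr.
- by move=> j w _; rewrite /f; case: ifP => // _; rewrite lee_fin sqr_ge0.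
Qed.

End rank_bounds.

(** * Expected loss at unit noise level *)

Section unit_noise_upper.
Context {R : realType} d {T : measurableType d} (P : probability T R).

Lemma weights_mono p (t : nat -> R) i j : weights p t -> (i <= j)%N -> (j < p)%N -> t j <= t i.
Proof.
move=> [_ tm]; elim: j => [|j IH]; first by rewrite leqn0 => /eqP ->.
rewrite leq_eqVlt => /orP[/eqP -> //|ij] jp.
by apply: le_trans (tm _ jp) (IH _ (ltnW jp)).
Qed.

(** Takes expectations in slope_upper. The ranks below C k are bounded by the
    excesses of all coordinates over the common level t (C.+1 * k).-1; the ranks
    above have p * tail (t (k + i)) = (k + i + 1) q, which is below i + 1 by
    the margin 1 + e that rank_bound_integral asks for. *)
Lemma slope_loss_upper p k C (t : nat -> R) (q c0 e0 e : R) (G : 'I_p -> T -> R)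
    (beta : 'cV[R]_p) (bh : T -> 'cV[R]_p) :
  pairwise_gauss P G -> (0 < k)%N -> (C.+1 * k <= p)%N -> weights p t ->
  (forall i, (i < p)%N -> p%:R * tail (t i) = i.+1%:R * q) ->
  0 < c0 -> (forall i, (i < p)%N -> c0 <= t i) ->
  0 < q -> q < 1 -> 2 <= C%:R * (1 - q) -> (norm0 beta <= k)%N -> 0 < e0 ->
  (forall w b, dot (beta + (\col_j G j w) - bh w) (b - bh w) <=
     penalty t b - penalty t (bh w)) ->
  e = (1 - q) / 2 ->
  (\int[P]_w (norm2 (bh w - beta) ^+ 2)%:E <=
    ((1 + e0) * \sum_(0 <= i < k) t i ^+ 2 + (1 + e0^-1) * (6 * k%:R) +
     2 * (C.+1 * k)%:R / c0 ^+ 2 +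
     (2 + 4 * e ^+ 2) / e ^+ 2 *
       \sum_(C * k <= i < p - k) (i.+1%:R * t (k + i)%N ^+ 2)^-1)%:E)%E.
Proof.
move=> pG k0 Ckp wt tl c00 ct q0 q1 Cq bk e00 vi eE.
have e_gt0 : 0 < e by rewrite eE divr_gt0// subr_gt0.
have kp : (k <= p)%N by apply: leq_trans Ckp; rewrite leq_pmull.
have Ckpk : (C * k <= p - k)%N.
  by rewrite -(leq_add2r k) subnK// -mulSnr.
have [S [Sk H]] := slope_upper kp wt bk e00.
pose r0 := (C.+1 * k).-1.
have r0E : r0.+1 = (C.+1 * k)%N by rewrite prednK// muln_gt0 k0.
have r0p : (r0 < p)%N by rewrite r0E.
pose tau0 := t r0.
have tau00 : 0 < tau0 by exact: lt_le_trans c00 (ct _ r0p).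
pose g w : 'cV[R]_p := \col_j G j w.
have gE w j : g w j 0 = G j w by rewrite mxE.
have ti0 i : (i < p)%N -> 0 < t i by move=> ip; exact: lt_le_trans c00 (ct _ ip).
have rkP i : (C * k <= i)%N -> (i < p - k)%N ->
    p%:R * tail (t (k + i)%N) * (1 + e) <= i.+1%:R.
  move=> Ci ipk; rewrite tl; last by rewrite -ltn_subRL.
  rewrite -addnS natrD eE; set K : R := k%:R; set N : R := i.+1%:R.
  have KN : C%:R * K <= N by rewrite -natrM ler_nat (leq_trans Ci).
  have K0 : 0 <= K by rewrite ler0n.
  have N0 : 0 <= N by rewrite ler0n.
  have h1 : 2 * K <= N * (1 - q).
    apply: (@le_trans _ _ (C%:R * (1 - q) * K)); first exact: ler_wpM2r.
    by rewrite mulrAC ler_wpM2r// subr_ge0 ltW.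
  have h2 : q * (1 + (1 - q) / 2) <= (1 + q) / 2 by nra.
  apply: (@le_trans _ _ ((K + N) * ((1 + q) / 2))).
    by rewrite -mulrA ler_wpM2l// addr_ge0.
  by nra.
pose F1 w := \sum_(j in S) G j w ^+ 2.
pose F2 w := \sum_j excess tau0 (G j w) ^+ 2.
pose F3 w := \sum_(C * k <= i < p - k) rank_bound G (t (k + i)%N) e i w.
pose L := (1 + e0) * \sum_(0 <= i < k) t i ^+ 2.
have L0 : 0 <= L.
  by rewrite mulr_ge0 ?addr_ge0 ?(ltW e00)// sumr_ge0// => i _; exact: sqr_ge0.
have ei0 : 0 <= 1 + e0^-1 by rewrite addr_ge0// invr_ge0 ltW.
have F10 w : 0 <= F1 w by apply: sumr_ge0 => j _; exact: sqr_ge0.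
have F20 w : 0 <= F2 w by apply: sumr_ge0 => j _; exact: sqr_ge0.
have F30 w : 0 <= F3 w by apply: sumr_ge0 => j _; exact: rank_bound_ge0.
have ptw w : norm2 (bh w - beta) ^+ 2 <= L + (1 + e0^-1) * F1 w + (F2 w + F3 w).
  apply: le_trans (H (g w) (bh w) (vi w)) _.
  rewrite (eq_bigr (fun j => G j w ^+ 2)) => [|j _]; last by rewrite gE.
  rewrite lerD2l (big_cat_nat (n := (C * k)%N))//=; apply: lerD.
    have [s sb] := ostat_perm (g w).
    pose F x : R := Num.max 0 (x - tau0) ^+ 2.
    apply: (@le_trans _ _ (\sum_(0 <= i < p) F (ostat (g w) i))).
      rewrite [leRHS](big_cat_nat (n := (C * k)%N))//=; last first.
        by rewrite (leq_trans Ckpk)// leq_subr.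
      rewrite -[leLHS]addr0; apply: lerD; last by apply: sumr_ge0 => i _; exact: sqr_ge0.
      rewrite big_nat_cond [leRHS]big_nat_cond.
      apply: ler_sum => i /andP[/andP[_ iCk] _]; rewrite /F.
      have tt : tau0 <= t (k + i)%N.
        by apply: weights_mono wt _ r0p; rewrite -ltnS r0E mulSn ltn_add2l.
      have mm : Num.max 0 (ostat (g w) i - t (k + i)%N) <= Num.max 0 (ostat (g w) i - tau0).
        by rewrite ge_max !le_max lexx/= lerB ?orbT.
      by rewrite ler_pXn2r// nnegrE le_max lexx.
    rewrite big_mkord (ostat_sum F sb) /F2 le_eqVlt; apply/orP; left; apply/eqP.
    by apply: eq_bigr => j _; rewrite gE.
  rewrite big_nat_cond /F3 [leRHS]big_nat_cond.
  apply: ler_sum => i /andP[/andP[Ci ipk] _].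
  apply: rank_bound_ostat => //.
  - by rewrite (leq_trans ipk)// leq_subr.
  - by apply: ti0; rewrite -ltn_subRL.
  - exact: rkP.
have mE (f : T -> R) : measurable_fun setT f -> measurable_fun setT (EFin \o f).
  by move=> mf; exact/measurable_EFinP.
have [mG _ _] := pG.
have mF1 : measurable_fun setT F1.
  rewrite /F1; under eq_fun do rewrite big_mkcond.
  apply: measurable_sum => j; case: (j \in S); last exact: measurable_cst.
  by apply: measurable_funX; exact: mG.
have mF2 : measurable_fun setT F2.
  apply: measurable_sum => j; apply: measurable_funX.
  by apply: measurableT_comp => //; exact: measurable_excess.
have mF3 : measurable_fun setT F3.
  by apply: measurable_sum => i; exact: (measurable_rank_bound _ _ _ pG).
apply: (@le_trans _ _ (\int[P]_w ((L%:E + (1 + e0^-1)%:E * (F1 w)%:E) + ((F2 w)%:E + (F3 w)%:E)))%E).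
  apply: le_integral_ge0 => w; first by rewrite lee_fin sqr_ge0.
  by rewrite -EFinM -!EFinD lee_fin.
have m1 : measurable_fun setT (fun w => ((1 + e0^-1)%:E * (F1 w)%:E)%E).
  by apply: emeasurable_funM => //; exact: mE.
have n1 w : (0 <= (1 + e0^-1)%:E * (F1 w)%:E)%E by rewrite -EFinM lee_fin mulr_ge0.
rewrite ge0_integralD//; last 4 first.
- by move=> w _; rewrite adde_ge0// lee_fin.
- exact: emeasurable_funD.
- by move=> w _; rewrite adde_ge0// lee_fin.
- by apply: emeasurable_funD; exact: mE.
rewrite [leRHS](_ : _ = ((L + (1 + e0^-1) * (6 * k%:R))%:E +
    (2 * (C.+1 * k)%:R / c0 ^+ 2 + (2 + 4 * e ^+ 2) / e ^+ 2 *
       \sum_(C * k <= i < p - k) (i.+1%:R * t (k + i)%N ^+ 2)^-1)%:E)%E); last first.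
  by rewrite -EFinD addrA.
apply: leeD.
  rewrite ge0_integralD//.
  rewrite integral_cst//= probability_setT mule1.
  rewrite [leRHS](_ : _ = (L%:E + ((1 + e0^-1) * (6 * k%:R))%:E)%E); last by rewrite -EFinD.
  apply: leeD => //.
  rewrite ge0_integralZl//; last first.
  - by move=> w _; rewrite lee_fin.
  - exact: mE.
  rewrite EFinM; apply: lee_wpmul2l; first by rewrite lee_fin.
  by rewrite -Sk; exact: noise_sum_integral.
rewrite ge0_integralD//; last 4 first.
- by move=> w _; rewrite lee_fin.
- exact: mE.
- by move=> w _; rewrite lee_fin.
- exact: mE.
rewrite [leRHS](_ : _ = ((2 * (C.+1 * k)%:R / c0 ^+ 2)%:E + ((2 + 4 * e ^+ 2) / e ^+ 2 *
  \sum_(C * k <= i < p - k) (i.+1%:R * t (k + i)%N ^+ 2)^-1)%:E)%E); last by rewrite -EFinD.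
apply: leeD.
  apply: le_trans (excess_sum_integral pG tau00) _.
  have tt := tl _ r0p; rewrite r0E in tt.
  have -> : p%:R * (2 * tail tau0 / tau0 ^+ 2) = 2 * ((C.+1 * k)%:R * q) / tau0 ^+ 2.
    by rewrite -tt /tau0; ring.
  rewrite lee_fin; apply: ler_pM.
  - by rewrite !mulr_ge0// ltW.
  - by rewrite invr_ge0 sqr_ge0.
  - by rewrite ler_wpM2l// ler_piMr// ltW.
  - rewrite lef_pV2 ?posrE ?exprn_gt0// ler_pXn2r ?nnegrE ?(ltW c00) ?(ltW tau00)//.
    exact: ct.
rewrite /F3; under eq_integral do rewrite -sumEFin.
rewrite ge0_integral_sum//; last 2 first.
- by move=> i; apply: mE; exact: (measurable_rank_bound _ _ _ pG).
- by move=> i w _; rewrite lee_fin rank_bound_ge0.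
rewrite mulr_sumr -sumEFin big_nat_cond [leRHS]big_nat_cond.
apply: lee_sum => i /andP[/andP[Ci ipk] _].
apply: rank_bound_integral => //; last exact: rkP.
by apply: ti0; rewrite -ltn_subRL.
Qed.

End unit_noise_upper.

Section unit_noise_lower.
Context {R : realType} d {T : measurableType d} (P : probability T R).

(** The right-hand side of slope_lower is replaced by its positive part, so that
    all integrands are nonnegative. The sum of the first k weights is at least
    k times the last of them. *)
Lemma slope_loss_lower p k (t : nat -> R) (e0 : R) (G : 'I_p -> T -> R)
    (S : {set 'I_p}) (bh : T -> 'cV[R]_p) :
  pairwise_gauss P G -> (0 < k)%N -> #|S| = k -> weights p t -> 0 < e0 -> e0 <= 1 ->
  let beta := spike S (4 * (\sum_(0 <= i < k) t i) + 1) in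
  (forall w b, dot (beta + (\col_j G j w) - bh w) (b - bh w) <=
     penalty t b - penalty t (bh w)) ->
  (((1 - e0) * (k%:R * t k.-1 ^+ 2) - e0^-1 * (6 * k%:R))%:E <=
   \int[P]_w (norm2 (bh w - beta) ^+ 2)%:E)%E.
Proof.
move=> pG k0 Sk wt e00 e01 beta vi.
have kp : (k <= p)%N by rewrite -Sk -[leqRHS]card_ord max_card.
have [mG _ _] := pG.
pose L := \sum_(0 <= i < k) t i.
pose A := (1 - e0) * (L ^+ 2 / k%:R).
pose B w := e0^-1 * \sum_(j in S) G j w ^+ 2.
have kR : 0 < k%:R :> R by rewrite ltr0n.
have A0 : 0 <= A by rewrite mulr_ge0 ?subr_ge0// divr_ge0 ?sqr_ge0.
have B0 w : 0 <= B w.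
  by rewrite mulr_ge0 ?invr_ge0 ?(ltW e00)// sumr_ge0// => j _; exact: sqr_ge0.
have fAB w : A - B w <= norm2 (bh w - beta) ^+ 2.
  have := slope_lower k0 Sk wt e00 (vi w); apply: le_trans.
  rewrite lerD2l lerN2 le_eqVlt; apply/orP; left; apply/eqP; congr (_ * _).
  by apply: eq_bigr => j _; rewrite mxE.
have mS : measurable_fun setT (fun w => (\sum_(j in S) G j w ^+ 2)%:E).
  apply/measurable_EFinP; under eq_fun do rewrite big_mkcond.
  apply: measurable_sum => j; case: (j \in S); last exact: measurable_cst.
  by apply: measurable_funX; exact: mG.
have mB : measurable_fun setT (fun w => (B w)%:E).
  by rewrite /B; under eq_fun do rewrite EFinM; exact: emeasurable_funM.
pose g w := Num.max 0 (A - B w).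
have g0 w : 0 <= g w by rewrite le_max lexx.
have mg : measurable_fun setT (fun w => (g w)%:E).
  apply/measurable_EFinP; apply: measurable_maxr => //; apply: measurable_funB => //.
  exact/measurable_EFinP.
have IB : (\int[P]_w (B w)%:E <= (e0^-1 * (6 * k%:R))%:E)%E.
  rewrite /B; under eq_integral do rewrite EFinM.
  rewrite ge0_integralZl//; last first.
  - by rewrite lee_fin invr_ge0 ltW.
  - by move=> w _; rewrite lee_fin sumr_ge0// => j _; exact: sqr_ge0.
  rewrite EFinM; apply: lee_wpmul2l; first by rewrite lee_fin invr_ge0 ltW.
  by rewrite -Sk; exact: noise_sum_integral.
have key : (A%:E <= \int[P]_w (norm2 (bh w - beta) ^+ 2)%:E + (e0^-1 * (6 * k%:R))%:E)%E.
  apply: (@le_trans _ _ (\int[P]_w ((g w)%:E + (B w)%:E))%E).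
    rewrite -[leLHS]mule1 -(probability_setT P) -integral_cst//.
    apply: le_integral_ge0 => w; first by rewrite lee_fin.
    by rewrite -EFinD lee_fin -lerBlDr le_max lexx orbT.
  rewrite ge0_integralD//; last 2 first.
  - by move=> w _; rewrite lee_fin.
  - by move=> w _; rewrite lee_fin.
  apply: leeD => //; apply: le_integral_ge0 => w; first by rewrite lee_fin.
  by rewrite lee_fin ge_max sqr_ge0 fAB.
have kL : k%:R * t k.-1 <= L.
  rewrite -[leLHS](_ : \sum_(0 <= i < k) t k.-1 = _); last first.
    by rewrite big_const_nat subn0 iter_addr_0 mulr_natl.
  rewrite /L big_nat_cond [leRHS]big_nat_cond; apply: ler_sum => i /andP[/andP[_ ik] _].
  have kp1 : (k.-1 < p)%N by rewrite prednK.
  by apply: weights_mono wt _ kp1; rewrite -ltnS prednK.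
have t0 : 0 <= t k.-1 by apply: (proj1 wt); rewrite prednK.
apply: (@le_trans _ _ (A%:E - (e0^-1 * (6 * k%:R))%:E)%E).
  rewrite -EFinB lee_fin lerD2r ler_wpM2l ?subr_ge0// ler_pdivlMr//.
  have -> : k%:R * t k.-1 ^+ 2 * k%:R = (k%:R * t k.-1) ^+ 2 by ring.
  by rewrite ler_pXn2r ?nnegrE ?mulr_ge0// (le_trans _ kL)// mulr_ge0.
by rewrite leeBlDr.
Qed.

End unit_noise_lower.

(** * Reduction to unit noise *)

Lemma le_ge0_integralZ d (T : measurableType d) (R : realType)
    (m : {measure set T -> \bar R}) (f : T -> \bar R) (c : R) : 0 < c ->
  (forall x, 0 <= f x)%E -> (\int[m]_x (c%:E * f x) <= c%:E * \int[m]_x f x)%E.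
Proof.
move=> c0 f0; have ci0 : 0 <= c^-1 by rewrite invr_ge0 ltW.
have cf0 x : (0 <= c%:E * f x)%E by rewrite mule_ge0// lee_fin ltW.
rewrite (ge0_integralTE _ cf0); apply: ge_ereal_sup => _ [h hf <-].
rewrite -lee_pdivrMl// -(@sintegralrM _ _ _ m c^-1 h).
rewrite (ge0_integralTE _ f0); apply: ereal_sup_ubound.
exists (scale_nnsfun h ci0) => // x /=.
by rewrite EFinM lee_pdivrMl//; exact: hf.
Qed.

(** Multiplication by c is an order isomorphism between the simple functions below
    f and those below c * f. *)
Lemma ge0_integralZ d (T : measurableType d) (R : realType)
    (m : {measure set T -> \bar R}) (f : T -> \bar R) (c : R) : 0 < c ->
  (forall x, 0 <= f x)%E -> (\int[m]_x (c%:E * f x) = c%:E * \int[m]_x f x)%E.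
Proof.
move=> c0 f0; apply/eqP; rewrite eq_le le_ge0_integralZ//=.
rewrite -lee_pdivlMl//.
have cf0 x : (0 <= c%:E * f x)%E by rewrite mule_ge0// lee_fin ltW.
apply: le_trans (le_ge0_integralZ m _ cf0); last by rewrite invr_gt0.
rewrite le_eqVlt; apply/orP; left; apply/eqP; apply: eq_integral => x _.
by rewrite muleA -EFinM mulVf ?gt_eqF// mul1e.
Qed.

Section unit_noise_reduction.
Context {R : realType}.

(** Substitution x = sigma * u in the density. *)
Lemma normal_prob_scale (sigma : R) (A : set R) : 0 < sigma -> measurable A ->
  normal_prob 0 sigma ((fun x : R => x / sigma) @^-1` A) = (gauss A)%:E.
Proof.
move=> s0 mA; have sne : sigma != 0 by rewrite gt_eqF.
set A' := _ @^-1` A.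
have mA' : measurable A'.
  by rewrite -[X in measurable X]setTI; apply: (measurable_funM _ _).
rewrite -gaussE//.
have H s B : measurable B -> normal_prob 0 s B =
    (\int[lebesgue_measure]_x ((\1_B x)%:E * (normal_pdf 0 s x)%:E))%E.
  move=> mB; transitivity (\int[normal_prob 0 s]_x (\1_B x)%:E)%E.
    by rewrite integral_indic// setIT.
  by rewrite ge0_integral_normal//; apply/measurable_EFinP; exact: measurable_indic.
rewrite !H// (@ge0_integral_affine _ sigma 0)//; last 2 first.
- apply: emeasurable_funM; apply/measurable_EFinP; first exact: measurable_indic.
  exact: measurable_normal_pdf.
- by move=> x; rewrite mule_ge0// lee_fin ?normal_pdf_ge0.
rewrite -ge0_integralZl//; last 2 first.
- have m1 : measurable_fun [set: R] (fun x : R => sigma * x + 0).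
    by apply: measurable_funD => //; exact: measurable_funM.
  apply: emeasurable_funM; apply/measurable_EFinP.
    by apply: (measurableT_comp _ m1); exact: measurable_indic.
  by apply: (measurableT_comp _ m1); exact: measurable_normal_pdf.
- by move=> x _; rewrite mule_ge0// lee_fin ?normal_pdf_ge0.
apply: eq_integral => x _; rewrite muleCA; congr (_ * _)%E.
  rewrite !indicE; congr (nat_of_bool _)%:R%:E.
  by apply/idP/idP; rewrite !inE /A' /= addr0 mulrAC divff// mul1r.
rewrite -EFinM; congr EFin; rewrite addr0 phiE normal_pdfE// /normal_fun subr0.
rewrite mulrA; congr (_ * _).
  rewrite /normal_peak expr1n mul1r gtr0_norm//.
  rewrite -mulrnAr sqrtrM ?sqr_ge0// sqrtr_sqr gtr0_norm// invfM.
  by rewrite mulrA divff// mul1r.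
by congr expR; rewrite -mulr_natr; field.
Qed.

Lemma gaussian_noise_iid d (T : measurableType d) (P : probability T R) n (sigma : R)
    (z : 'I_n -> {RV P >-> R}) : 0 < sigma -> gaussian_noise sigma z ->
  iid_gauss P (fun i w => z i w / sigma).
Proof.
move=> s0 [zd zi]; split => [i|A mA].
  by apply: measurable_funM.
pose A' i := (fun x : R => x / sigma) @^-1` (A i).
have mA' i : measurable (A' i).
  by rewrite -[X in measurable X]setTI; apply: (measurable_funM _ _).
have := zi [set: 'I_n]%SET A' mA'.
rewrite (_ : \bigcap_(i in _) _ = [set w | forall i, A i (z i w / sigma)]).
  move=> ->; rewrite (eq_bigr (fun i => (gauss (A i))%:E)); last first.
    by move=> i _; rewrite -(normal_prob_scale s0 (mA i)) -(zd i _ (mA' i)).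
  rewrite (eq_bigl xpredT) => [|i]; last by rewrite inE.
  by rewrite prodEFin.
apply/seteqP; split => w /=.
  by move=> H i; apply: (H i); rewrite /= inE.
by move=> H i _; exact: H.
Qed.

Definition std_noise d (T : measurableType d) (P : probability T R) n p (sigma : R)
   (X : 'M[R]_(n, p)) (z : 'I_n -> {RV P >-> R}) (j : 'I_p) (w : T) : R :=
  fdot (X ^~ j) (fun i => z i w / sigma).

Lemma std_noise_pairwise d (T : measurableType d) (P : probability T R) n p (sigma : R)
    (X : 'M[R]_(n, p)) (z : 'I_n -> {RV P >-> R}) : X^T *m X = 1%:M ->
  0 < sigma -> gaussian_noise sigma z -> pairwise_gauss P (std_noise sigma X z).
Proof.
move=> XX s0 gz; have iZ := gaussian_noise_iid s0 gz.
have XE j l : fdot (X ^~ j) (X ^~ l) = (j == l)%:R.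
  have := congr1 (fun M : 'M[R]_p => M j l) XX; rewrite !mxE => <-.
  by apply: eq_bigr => i _; rewrite mxE.
split.
- move=> j; apply: measurable_sum => i; apply: measurable_funM => //.
  exact: (proj1 iZ).
- move=> j A mA; rewrite gaussE//.
  by apply: (gauss_lin1 iZ _ mA); rewrite XE eqxx.
- move=> j l A B jl mA mB; rewrite !gaussE//.
  by apply: (gauss_lin2 iZ _ _ _ mA mB); rewrite XE ?eqxx// (negbTE jl).
Qed.

(** The SLOPE weight of 0-based rank i, divided by sigma. *)
Definition unit_weight (q : R) (p i : nat) : R :=
  Phi_inv (1 - i.+1%:R * q / (2 * p%:R)).

Lemma unit_weight_level (q : R) (p i : nat) : 0 < q -> q < 1 -> (i < p)%N ->
  0 < 1 - i.+1%:R * q / (2 * p%:R) < 1.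
Proof.
move=> q0 q1 ip; have p0 : 0 < p%:R :> R by rewrite ltr0n (leq_ltn_trans _ ip).
have ip' : i.+1%:R <= p%:R :> R by rewrite ler_nat.
have i0 : 0 < i.+1%:R :> R by [].
apply/andP; split.
  by rewrite subr_gt0 ltr_pdivrMr ?mulr_gt0//; nra.
by rewrite gtrBl divr_gt0 ?mulr_gt0.
Qed.

Lemma Phi_unit_weight (q : R) (p i : nat) : 0 < q -> q < 1 -> (i < p)%N ->
  Phi (unit_weight q p i) = 1 - i.+1%:R * q / (2 * p%:R).
Proof. by move=> *; apply: Phi_invK; exact: unit_weight_level. Qed.

(** The defining property of the weights: p coordinates of pure noise have
    (i + 1) q crossings of the weight of rank i on average, fewer than i + 1. *)
Lemma tail_unit_weight (q : R) (p i : nat) : 0 < q -> q < 1 -> (i < p)%N ->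
  p%:R * tail (unit_weight q p i) = i.+1%:R * q.
Proof.
move=> q0 q1 ip; rewrite /tail Phi_unit_weight//.
by field; rewrite pnatr_eq0 -lt0n (leq_ltn_trans _ ip).
Qed.

(** A positive lower bound of all the weights. The level (1 + q) / 4 lies strictly
    between q / 2, the largest one-sided level of a weight, and 1 / 2. *)
Definition min_weight (q : R) : R := Phi_inv (1 - (1 + q) / 4).

Lemma Phi_min_weight (q : R) : 0 < q -> q < 1 -> Phi (min_weight q) = 1 - (1 + q) / 4.
Proof. by move=> q0 q1; apply: Phi_invK; apply/andP; split; lra. Qed.

Lemma min_weight_gt0 (q : R) : 0 < q -> q < 1 -> 0 < min_weight q.
Proof.
move=> q0 q1; rewrite ltNge; apply/negP => /Phi_mono.
by rewrite Phi0 Phi_min_weight//; lra.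
Qed.

Lemma min_weight_le (q : R) (p i : nat) : 0 < q -> q < 1 -> (i < p)%N -> min_weight q <= unit_weight q p i.
Proof.
move=> q0 q1 ip; rewrite leNgt; apply/negP => /ltW/Phi_mono.
rewrite Phi_unit_weight// Phi_min_weight//.
have p0 : 0 < p%:R :> R by rewrite ltr0n (leq_ltn_trans _ ip).
have ip' : i.+1%:R <= p%:R :> R by rewrite ler_nat.
have : i.+1%:R * q / (2 * p%:R) <= q / 2.
  by rewrite ler_pdivrMr ?mulr_gt0//; nra.
lra.
Qed.

Lemma unit_weight_weights (q : R) (p : nat) : 0 < q -> q < 1 -> weights p (unit_weight q p).
Proof.
move=> q0 q1; split => i ip.
  by rewrite (le_trans _ (min_weight_le q0 q1 ip))// ltW// min_weight_gt0.
rewrite leNgt; apply/negP => /ltW/Phi_mono; rewrite !Phi_unit_weight//; last exact: ltnW.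
rewrite lerD2l lerN2 ler_pM2r; last first.
  by rewrite invr_gt0 mulr_gt0// ltr0n (leq_ltn_trans _ ip).
by rewrite ler_pM2r// ler_nat ltnn.
Qed.

Section one_problem.
Context d (T : measurableType d) (P : probability T R) (n p : nat) (q sigma : R).
Variables (X : 'M[R]_(n, p)) (z : 'I_n -> {RV P >-> R}) (betahat : 'cV[R]_n -> 'cV[R]_p).
Hypotheses (q0 : 0 < q) (q1 : q < 1) (s0 : 0 < sigma) (XX : X^T *m X = 1%:M)
  (gz : gaussian_noise sigma z)
  (slope : is_slope_estimator X (slope_weight q sigma p) betahat).

Let G := std_noise sigma X z.
Let t := unit_weight q p.

Lemma penalty_scaleE (a : R) (b : 'cV[R]_p) : 0 < a ->
  penalty t (a *: b) = a * penalty t b.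
Proof.
move=> a0; have tw : weights p t by exact: unit_weight_weights.
apply/eqP; rewrite eq_le penaltyZ ?(ltW a0)//=.
have : penalty t (a^-1 *: (a *: b)) <= a^-1 * penalty t (a *: b).
  by rewrite penaltyZ// invr_ge0 ltW.
by rewrite scalerA mulVf ?gt_eqF// scale1r ler_pdivlMl.
Qed.

(** Dividing the observation and the weights by sigma divides the estimate by
    sigma, since the penalty is positively homogeneous. *)
Lemma scaled_variational (beta : 'cV[R]_p) w b :
  dot (beta + (\col_j G j w) - sigma^-1 *: betahat (observation X (sigma *: beta) z w))
      (b - sigma^-1 *: betahat (observation X (sigma *: beta) z w)) <=
  penalty t b - penalty t (sigma^-1 *: betahat (observation X (sigma *: beta) z w)).
Proof.
set y := observation _ _ _ _; set bh := betahat y.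
have tw : weights p t by exact: unit_weight_weights.
have penE c : penalty (fun i => slope_weight q sigma p i.+1) c = sigma * penalty t c.
  by rewrite /penalty mulr_sumr; apply: eq_bigr => i _; rewrite /slope_weight mulrA.
have lw : weights p (fun i => slope_weight q sigma p i.+1).
  have [t0 tm] := tw; split => i ip; rewrite /slope_weight.
    by rewrite mulr_ge0 ?(ltW s0)//; exact: t0.
  by rewrite ler_wpM2l ?(ltW s0)//; exact: tm.
have := slope_variational XX lw (slope y) (sigma *: b).
rewrite !penE penalty_scaleE// -/bh.
have -> : X^T *m y = sigma *: (beta + \col_j G j w).
  rewrite /y /observation mulmxDr mulmxA XX mul1mx scalerDr; congr (_ + _).
  apply/colP => j; rewrite !mxE /G /std_noise /fdot mulr_sumr; apply: eq_bigr => i _.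
  by rewrite !mxE mulrCA; congr (_ * _); rewrite mulrC divfK// gt_eqF.
have -> : penalty t bh = sigma * penalty t (sigma^-1 *: bh).
  by rewrite -penalty_scaleE// scalerA divff ?gt_eqF// scale1r.
have -> : dot (sigma *: (beta + \col_j G j w) - bh) (sigma *: b - bh) =
   sigma ^+ 2 * dot (beta + \col_j G j w - sigma^-1 *: bh) (b - sigma^-1 *: bh).
  rewrite /dot mulr_sumr; apply: eq_bigr => j _; rewrite !mxE.
  by field; rewrite gt_eqF.
by rewrite -!mulrBr expr2 -mulrA ler_pM2l// ler_pM2l.
Qed.

Lemma risk_scaled (beta : 'cV[R]_p) :
  risk X z betahat (sigma *: beta) = ((sigma ^+ 2)%:E *
   \int[P]_w (norm2 ((sigma^-1 *: betahat (observation X (sigma *: beta) z w)) - beta) ^+ 2)%:E)%E.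
Proof.
rewrite /risk unlock -ge0_integralZ ?exprn_gt0//; last first.
  by move=> w; rewrite lee_fin sqr_ge0.
apply: eq_integral => w _; rewrite -EFinM; congr EFin.
rewrite !norm2_sqr mulr_sumr; apply: eq_bigr => j _; rewrite !mxE.
by field; rewrite gt_eqF.
Qed.

End one_problem.
End unit_noise_reduction.

(** * Asymptotics of the weights *)

Section weight_asymptotics.
Context {R : realType}.
Variable (q : R).
Hypotheses (q0 : 0 < q) (q1 : q < 1).
Notation t := (unit_weight q).
Notation c0 := (min_weight q).

(** Equivalent to k^k / k! <= e^k, where the left-hand side is a term of the series. *)
Lemma sum_ln_ratio (k : nat) : \sum_(0 <= i < k) ln (k%:R / i.+1%:R : R) <= k%:R.
Proof.
case: k => [|k]; first by rewrite big_geq.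
have K0 : 0 < k.+1%:R :> R by [].
rewrite -ler_expR expR_sum.
rewrite (eq_bigr (fun i => k.+1%:R / i.+1%:R)) => [|i _]; last first.
  by rewrite lnK// posrE divr_gt0.
have -> : \prod_(0 <= i < k.+1) (k.+1%:R / i.+1%:R : R) = k.+1%:R ^+ k.+1 / k.+1`!%:R.
  rewrite big_split/= big_const_nat subn0 iter_mulr_1; congr (_ * _).
  by rewrite prodfV fact_prod natr_prod big_add1.
by apply: le_trans (expR_ge1Dxn k (ltW K0)); rewrite lerDr.
Qed.

(** The constant left over by the normal tail bound and by sum_ln_ratio. *)
Definition weight_ub_cst : R := ln (2 * normal_peak 1 / c0 / q) + 1.

(** By the upper bound on normal tails, half the square of the weight of rank i
    is at most log(p/k) + log(k/(i+1)) up to a constant; the second logarithms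
    sum up to at most k. *)
Lemma sum_weight_sqr_ub (p k : nat) : (0 < k)%N -> (k <= p)%N ->
  \sum_(0 <= i < k) t p i ^+ 2 <= 2 * k%:R * (ln (p%:R / k%:R) + weight_ub_cst).
Proof.
move=> k0 kp; have c00 := min_weight_gt0 q0 q1; have pk0 := @peak_gt0 R.
set K := 2 * normal_peak 1 / c0.
have K0 : 0 < K by rewrite divr_gt0// mulr_gt0.
have kR : 0 < k%:R :> R by rewrite ltr0n.
have pR : 0 < p%:R :> R by rewrite ltr0n (leq_trans k0).
have term i : (i < k)%N ->
    t p i ^+ 2 <= 2 * (ln (K / q) + ln (p%:R / k%:R)) + 2 * ln (k%:R / i.+1%:R).
  move=> ik; have ip : (i < p)%N by exact: leq_trans kp.
  have H := tail_ub c00 (min_weight_le q0 q1 ip); rewrite -/K in H.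
  have i0 : 0 < i.+1%:R :> R by [].
  have tE := tail_unit_weight q0 q1 ip.
  have H2 : i.+1%:R * q <= p%:R * K / expR (t p i ^+ 2 / 2).
    by rewrite -tE -mulrA ler_pM2l// -expRN.
  have H3 : expR (t p i ^+ 2 / 2) <= K / q * (p%:R / k%:R) * (k%:R / i.+1%:R).
    rewrite ler_pdivlMr ?expR_gt0// in H2.
    rewrite [leRHS](_ : _ = p%:R * K / (i.+1%:R * q)); last by field; rewrite !gt_eqF.
    by rewrite ler_pdivlMr ?mulr_gt0// mulrC.
  have a1 : 0 < K / q by rewrite divr_gt0.
  have a2 : 0 < p%:R / k%:R :> R by rewrite divr_gt0.
  have a3 : 0 < k%:R / i.+1%:R :> R by rewrite divr_gt0.
  have : t p i ^+ 2 / 2 <= ln (K / q * (p%:R / k%:R) * (k%:R / i.+1%:R)).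
    rewrite -[leLHS]expRK ler_ln ?posrE ?expR_gt0//.
    by apply: mulr_gt0 => //; exact: mulr_gt0.
  rewrite lnM ?posrE//; last exact: mulr_gt0.
  by rewrite lnM ?posrE//; lra.
apply: (@le_trans _ _ (\sum_(0 <= i < k) (2 * (ln (K / q) + ln (p%:R / k%:R)) +
    2 * ln (k%:R / i.+1%:R)))).
  rewrite big_nat_cond [leRHS]big_nat_cond; apply: ler_sum => i /andP[/andP[_ ik] _].
  exact: term.
have Hc (c : R) : \sum_(0 <= i < k) c = k%:R * c.
  by rewrite big_const_nat subn0 iter_addr_0 mulr_natl.
rewrite big_split/= Hc -mulr_sumr /weight_ub_cst -/K.
by have := sum_ln_ratio k; lra.
Qed.

(** The constant left over by the lower bound on the normal tail. *)
Definition weight_lb_cst : R := ln (2 * normal_peak 1 / q).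

Lemma last_weight_lb (p k : nat) : (0 < k)%N -> (k <= p)%N ->
  2 * (ln (p%:R / k%:R) + weight_lb_cst) <= (t p k.-1 + 1) ^+ 2.
Proof.
move=> k0 kp; have pk0 := @peak_gt0 R.
have kR : 0 < k%:R :> R by rewrite ltr0n.
have pR : 0 < p%:R :> R by rewrite ltr0n (leq_trans k0).
have kp1 : (k.-1 < p)%N by rewrite prednK.
have t0 : 0 <= t p k.-1 by apply: (proj1 (unit_weight_weights p q0 q1)).
have H := tail_lb t0; have tE := tail_unit_weight q0 q1 kp1; rewrite prednK// in tE.
set s := t p k.-1 in H tE t0 *.
have H2 : p%:R * (2 * normal_peak 1) / expR ((s + 1) ^+ 2 / 2) <= k%:R * q.
  by rewrite -tE -mulrA ler_pM2l// -expRN.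
have H3 : p%:R / k%:R * (2 * normal_peak 1 / q) <= expR ((s + 1) ^+ 2 / 2).
  move: H2; rewrite ler_pdivrMr ?expR_gt0// => H2.
  rewrite [leLHS](_ : _ = p%:R * (2 * normal_peak 1) / (k%:R * q)); last by field; rewrite !gt_eqF.
  by rewrite ler_pdivrMr ?mulr_gt0// [leRHS]mulrC.
have a1 : 0 < p%:R / k%:R :> R by rewrite divr_gt0.
have a2 : 0 < 2 * normal_peak 1 / q by rewrite divr_gt0// mulr_gt0.
have : ln (p%:R / k%:R * (2 * normal_peak 1 / q)) <= (s + 1) ^+ 2 / 2.
  by rewrite -[leRHS]expRK ler_ln ?posrE ?expR_gt0// mulr_gt0.
by rewrite lnM ?posrE// /weight_lb_cst; lra.
Qed.

Lemma harmonic_le_ln (a b : nat) : (0 < a)%N -> (a <= b)%N ->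
  \sum_(a <= i < b) (i.+1%:R : R)^-1 <= ln (b%:R / a%:R).
Proof.
move=> a0; have aR : 0 < a%:R :> R by rewrite ltr0n.
elim: b => [|b IH]; first by rewrite leqn0 => /eqP ->; rewrite big_geq// invr0 mulr0 ln0.
rewrite leq_eqVlt => /orP[/eqP <-|ab]; first by rewrite big_geq// divff ?gt_eqF// ln1.
have bR : 0 < b%:R :> R by rewrite ltr0n (leq_trans a0).
rewrite big_nat_recr//=.
have -> : b.+1%:R / a%:R = b%:R / a%:R * (b.+1%:R / b%:R) :> R by field; rewrite !gt_eqF.
rewrite lnM ?posrE ?divr_gt0//; apply: lerD; first exact: IH.
rewrite -ler_expR lnK ?posrE ?divr_gt0//.
have := expR_ge1Dx (- (b.+1%:R : R)^-1); rewrite expRN => H.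
rewrite -[leLHS]invrK -[leRHS]invrK lef_pV2 ?posrE ?invr_gt0 ?divr_gt0 ?expR_gt0//.
apply: le_trans H; rewrite invf_div -natr1.
have b1 : 0 < b%:R + 1 :> R by rewrite addr_gt0.
by rewrite le_eqVlt; apply/orP; left; apply/eqP; field; rewrite gt_eqF.
Qed.

(** The lower bound of tail_lb at M: a weight smaller than M has a tail of at least level M. *)
Definition level (M : R) : R := 2 * normal_peak 1 * expR (- ((M + 1) ^+ 2 / 2)).

(** A weight of at least M contributes at most 1 / ((i+1) M^2), and the harmonic
    sum over [k, p[ is at most log(p/k). A weight below M has a tail of at
    least level M, so its rank is at least proportional to p, and the at most
    p terms of this kind have a bounded sum. *)
Lemma rank_sum_ub (p k C : nat) (M : R) : (0 < k)%N -> (0 < C)%N -> (C.+1 * k <= p)%N -> 0 < M ->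
  \sum_(C * k <= i < p - k) (i.+1%:R * t p (k + i)%N ^+ 2)^-1 <=
  ln (p%:R / k%:R) / M ^+ 2 + 2 * q / (level M * c0 ^+ 2).
Proof.
move=> k0 C0 Ckp M0; have c00 := min_weight_gt0 q0 q1; have pk0 := @peak_gt0 R.
have kR : 0 < k%:R :> R by rewrite ltr0n.
have kp : (k <= p)%N by apply: leq_trans Ckp; rewrite leq_pmull.
have pR : 0 < p%:R :> R by rewrite ltr0n (leq_trans k0).
have lv0 : 0 < level M by rewrite mulr_gt0 ?expR_gt0// mulr_gt0.
have kCk : (k <= C * k)%N by rewrite leq_pmull.
have M2 : 0 < M ^+ 2 by rewrite exprn_gt0.
have c2 : 0 < c0 ^+ 2 by rewrite exprn_gt0.
pose D := 2 * q / (level M * c0 ^+ 2) / p%:R.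
have D0 : 0 <= D by rewrite !divr_ge0 ?mulr_ge0// ltW// ?mulr_gt0.
have term i : (C * k <= i)%N -> (i < p - k)%N ->
    (i.+1%:R * t p (k + i)%N ^+ 2)^-1 <= i.+1%:R^-1 / M ^+ 2 + D.
  move=> Ci ipk; have kip : (k + i < p)%N by rewrite -ltn_subRL.
  have i0 : 0 < i.+1%:R :> R by [].
  have ct := min_weight_le q0 q1 kip.
  set s := t p (k + i)%N in ct *.
  have sp : 0 < s by exact: lt_le_trans ct.
  rewrite invfM; have [Ms|sM] := leP M s.
    rewrite -[leLHS]addr0 lerD// ler_wpM2l ?invr_ge0 ?(ltW i0)//.
    by rewrite lef_pV2 ?posrE ?exprn_gt0// ler_pXn2r ?nnegrE ?(ltW M0) ?(ltW sp).
  have H := tail_lb (ltW sp); have tE := tail_unit_weight q0 q1 kip; rewrite -/s in tE.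
  have lvt : level M <= tail s.
    apply: le_trans H; rewrite /level ler_pM2l ?mulr_gt0// ler_expR lerN2.
    by rewrite ler_pM2r ?invr_gt0//; nra.
  have ki : (k + i).+1%:R <= 2 * i.+1%:R :> R.
    rewrite -natrM ler_nat mul2n -addnn -addnS leq_add2r ltnW// ltnS.
    exact: leq_trans kCk Ci.
  have Hi : i.+1%:R^-1 <= 2 * q / (level M * p%:R).
    rewrite ler_pdivlMr; last exact: mulr_gt0.
    rewrite ler_pdivrMl// [leLHS]mulrC.
    have : p%:R * level M <= p%:R * tail s by rewrite ler_pM2l.
    rewrite tE => Hp; apply: (le_trans Hp).
    by rewrite mulrA [_ * 2]mulrC ler_pM2r.
  apply: (@le_trans _ _ (2 * q / (level M * p%:R) * (c0 ^+ 2)^-1)).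
    apply: ler_pM => //; rewrite ?invr_ge0 ?sqr_ge0 ?(ltW i0)//.
    by rewrite lef_pV2 ?posrE ?exprn_gt0// ler_pXn2r ?nnegrE ?(ltW c00) ?(ltW sp).
  have -> : 2 * q / (level M * p%:R) * (c0 ^+ 2)^-1 = D.
    by rewrite /D; field; rewrite !gt_eqF.
  by rewrite lerDr divr_ge0 ?invr_ge0// ltW.
apply: (@le_trans _ _ (\sum_(C * k <= i < p - k) (i.+1%:R^-1 / M ^+ 2 + D))).
  rewrite big_nat_cond [leRHS]big_nat_cond; apply: ler_sum => i /andP[/andP[Ci ipk] _].
  exact: term.
rewrite big_split/= -mulr_suml; apply: lerD.
  rewrite ler_pM2r ?invr_gt0//; apply: le_trans (harmonic_le_ln k0 kp).
  have Ckpk : (C * k <= p - k)%N by rewrite -(leq_add2r k) subnK// -mulSnr.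
  rewrite [leRHS](big_cat_nat (n := (C * k)%N))//=; last first.
    by rewrite (leq_trans Ckpk)// leq_subr.
  rewrite [X in _ <= _ + X](big_cat_nat (n := (p - k)%N))//= ?leq_subr//.
  by rewrite addrCA lerDl addr_ge0// sumr_ge0//.
rewrite big_const_nat iter_addr_0 -[leLHS]mulr_natl.
apply: (@le_trans _ _ (p%:R * D)).
  by rewrite ler_wpM2r// ler_nat (leq_trans (leq_subr _ _))// leq_subr.
by rewrite /D le_eqVlt; apply/orP; left; apply/eqP; field; rewrite !gt_eqF.
Qed.

End weight_asymptotics.

(** * Bounds on the maximal risk *)

Section maximal_risk.
Context {R : realType}.

Lemma norm0_scale p (a : R) (b : 'cV[R]_p) : (norm0 (a *: b) <= norm0 b)%N.
Proof.
apply: subset_leq_card; apply/fintype.subsetP => i; rewrite !inE mxE.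
by apply: contra => /eqP ->; rewrite mulr0.
Qed.

Lemma norm0_spike p (S : {set 'I_p}) (M : R) : (norm0 (spike S M) <= #|S|)%N.
Proof.
apply: subset_leq_card; apply/fintype.subsetP => i; rewrite !inE mxE.
by case: ifP => // _; rewrite eqxx.
Qed.

Definition slope_max_risk d (T : measurableType d) (P : probability T R) n p
    (X : 'M[R]_(n, p)) (z : 'I_n -> {RV P >-> R}) (betahat : 'cV[R]_n -> 'cV[R]_p)
    (k : nat) : \bar R :=
  ereal_sup [set risk X z betahat beta
            | beta in [set beta : 'cV[R]_p | (norm0 beta <= k)%N]].

(** All the error terms of slope_loss_upper and slope_loss_lower are of the form
    k times a constant, except a fraction e0 = del / 4 of the main term on each
    side and the sum over ranks, where M is chosen so large that its logarithmic
    part is at most del / 4 times log(p/k). The constants W and W2 collect the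
    rest, and log(p/k) >= l0 absorbs them. *)
Lemma slope_max_risk_bounds (q sigma del : R) :
  0 < q -> q < 1 -> 0 < sigma -> 0 < del -> del <= 1 ->
  exists l0 : R, 0 < l0 /\ forall d (T : measurableType d) (P : probability T R) n p k
    (X : 'M[R]_(n, p)) (z : 'I_n -> {RV P >-> R}) (betahat : 'cV[R]_n -> 'cV[R]_p),
    X^T *m X = 1%:M -> gaussian_noise sigma z ->
    is_slope_estimator X (slope_weight q sigma p) betahat ->
    (0 < k)%N -> (0 < p)%N -> l0 <= ln (p%:R / k%:R) ->
    (((1 - del) * (2 * sigma ^+ 2 * k%:R * ln (p%:R / k%:R)))%:E
       <= slope_max_risk X z betahat k)%E /\
    (slope_max_risk X z betahat k
       <= ((1 + del) * (2 * sigma ^+ 2 * k%:R * ln (p%:R / k%:R)))%:E)%E.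
Proof.
move=> q0 q1 s0 del0 del1.
pose e := (1 - q) / 2; pose e0 := del / 4; pose c0 := min_weight q.
have e_gt0 : 0 < e by rewrite divr_gt0// subr_gt0.
have e00 : 0 < e0 by rewrite divr_gt0.
have e01 : e0 <= 4^-1 by rewrite /e0; lra.
have c00 : 0 < c0 by exact: min_weight_gt0.
(* C is large enough for (k + i + 1) q (1 + e) <= i + 1 when i >= C k. *)
pose C := (Num.truncn (2 / (1 - q))).+1.
have Cq : 2 <= C%:R * (1 - q).
  by rewrite -ler_pdivrMr ?subr_gt0// ltW// /C truncnS_gt.
pose A2 := (2 + 4 * e ^+ 2) / e ^+ 2.
have A20 : 0 < A2.
  by rewrite divr_gt0 ?exprn_gt0// addr_gt0// mulr_gt0// exprn_gt0.
pose M := 4 * A2 / del + 1.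
have M1 : 1 <= M by rewrite /M lerDr ltW// divr_gt0// mulr_gt0.
have M0 : 0 < M by exact: lt_le_trans M1.
have MA : A2 / M ^+ 2 <= del / 4.
  rewrite ler_pdivrMr ?exprn_gt0//.
  have h1 : M <= M ^+ 2 by rewrite expr2 ler_peMr// ltW.
  have h2 : A2 <= del / 4 * M.
    rewrite /M mulrDr mulr1 [X in _ <= X + _](_ : _ = A2); last by field; rewrite gt_eqF.
    by rewrite lerDl divr_ge0// ltW.
  by apply: le_trans h2 _; rewrite ler_wpM2l// divr_ge0// ltW.
pose K3 := 2 * q / (level M * c0 ^+ 2).
have K30 : 0 <= K3.
  rewrite divr_ge0 ?mulr_ge0 ?sqr_ge0 ?expR_ge0 ?ltW//.
  exact: peak_gt0.
pose K1 := weight_ub_cst q; pose K2 := weight_lb_cst q.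
pose W := 2 * (1 + e0) * `|K1| + 6 * (1 + e0^-1) + 2 * C.+1%:R / c0 ^+ 2 + A2 * K3.
pose W2 := 2 * `|K2| + 1 + 7 / e0.
have i0 : 0 < e0^-1 by rewrite invr_gt0.
have W0 : 0 <= W.
  rewrite /W; apply: addr_ge0; first (apply: addr_ge0; first apply: addr_ge0).
  - by rewrite mulr_ge0// mulr_ge0// addr_ge0// ltW.
  - by rewrite mulr_ge0// addr_ge0// ltW.
  - by apply: divr_ge0; [exact: mulr_ge0|exact: sqr_ge0].
  - by rewrite mulr_ge0// ltW.
have W2_ge0 : 0 <= W2 by rewrite /W2 !addr_ge0 ?mulr_ge0 ?(ltW i0).
have lC : 0 <= ln C.+1%:R :> R by rewrite ln_ge0// ler1n.
have WW0 : 0 <= (W + W2) / del by apply: divr_ge0; [exact: addr_ge0|exact: ltW].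
pose l0 : R := (W + W2) / del + ln C.+1%:R + 1.
exists l0; split.
  by rewrite /l0 ltr_wpDl// addr_ge0.
move=> d T P n p k X z betahat XX gz sl k0 p0; set l := ln _ => ll.
have kR : 0 < k%:R :> R by rewrite ltr0n.
have pR : 0 < p%:R :> R by rewrite ltr0n.
have k1 : 1 <= k%:R :> R by rewrite ler1n.
have Wl : W + W2 <= l * del.
  by rewrite -ler_pdivrMr//; apply: le_trans ll; rewrite /l0; set x := _ / _; lra.
have l_ge0 : 0 <= l.
  by apply: le_trans ll; rewrite /l0 !addr_ge0.
have Ckp : (C.+1 * k <= p)%N.
  rewrite -(ler_nat R) natrM -ler_pdivlMr// -[leLHS]lnK ?posrE//.
  rewrite -[leRHS]lnK ?posrE ?divr_gt0// ler_expR; apply: le_trans ll.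
  by rewrite /l0 addrAC lerDr addr_ge0.
have kp : (k <= p)%N by apply: leq_trans Ckp; rewrite leq_pmull.
have tw : weights p (unit_weight q p) by exact: unit_weight_weights.
have pG := std_noise_pairwise XX s0 gz.
have s2 : 0 < sigma ^+ 2 by rewrite exprn_gt0.
split.
  pose S : {set 'I_p} := topset (1%g : {perm 'I_p}) k.
  have Sk : #|S| = k by rewrite card_topset.
  pose beta := spike S (4 * (\sum_(0 <= i < k) unit_weight q p i) + 1).
  apply: (@le_trans _ _ (risk X z betahat (sigma *: beta))); last first.
    apply: ereal_sup_ubound; exists (sigma *: beta) => //=.
    by rewrite (leq_trans (norm0_scale _ _))// -[X in (_ <= X)%N]Sk norm0_spike.
  rewrite risk_scaled//.
  have H := @slope_loss_lower _ _ _ P p k (unit_weight q p) e0 _ S _ pG k0 Sk tw e00 _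
    (scaled_variational z q0 q1 s0 XX sl beta).
  apply: (@le_trans _ _ ((sigma ^+ 2)%:E * ((1 - e0) * (k%:R * unit_weight q p k.-1 ^+ 2) -
      e0^-1 * (6 * k%:R))%:E)%E); last first.
    by apply: lee_wpmul2l; [rewrite lee_fin ltW|apply: H; lra].
  have HL := last_weight_lb q0 q1 k0 kp; rewrite -/l -/K2 in HL.
  set s := unit_weight q p k.-1 in HL *.
  have h1 : (s + 1) ^+ 2 <= (1 + e0) * s ^+ 2 + (1 + e0^-1).
    rewrite -subr_ge0 [leRHS](_ : _ = e0^-1 * (e0 * s - 1) ^+ 2); last by field; rewrite gt_eqF.
    by rewrite mulr_ge0 ?sqr_ge0// invr_ge0 ltW.
  have K2n : - `|K2| <= K2 by have := lerNnormlW (lexx `|K2|).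
  have key : (1 - del) * (2 * l) <= (1 - e0) * s ^+ 2 - 6 * e0^-1.
    have h2 : (1 - 2 * e0) * (2 * l + 2 * K2 - 1 - e0^-1) <= (1 - e0) * s ^+ 2.
      apply: (@le_trans _ _ ((1 - 2 * e0) * ((1 + e0) * s ^+ 2))).
        by apply: ler_wpM2l; lra.
      rewrite mulrA ler_wpM2r ?sqr_ge0//; nra.
    have h3 : W2 <= l * del by lra.
    rewrite /W2 in h3.
    have h4 : (1 - 2 * e0) * (2 * `|K2| + 1 + e0^-1) <= 2 * `|K2| + 1 + e0^-1.
      have X0 : 0 <= 2 * `|K2| + 1 + e0^-1.
        by have := normr_ge0 K2; move: i0; lra.
      by rewrite -[leRHS]mul1r; apply: ler_wpM2r => //; lra.
    have dE : del = 4 * e0 by rewrite /e0; field.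
    have h5 : (1 - 2 * e0) * (2 * l - (2 * `|K2| + 1 + e0^-1)) <= (1 - e0) * s ^+ 2.
      apply: le_trans h2; apply: ler_wpM2l; lra.
    rewrite dE in h3 *; lra.
  rewrite -EFinM lee_fin.
  rewrite [leLHS](_ : _ = sigma ^+ 2 * (k%:R * ((1 - del) * (2 * l)))); last by ring.
  rewrite ler_pM2l//.
  rewrite [leRHS](_ : _ = k%:R * ((1 - e0) * s ^+ 2 - 6 * e0^-1)); last by ring.
  by rewrite ler_pM2l.
apply: ge_ereal_sup => _ [beta bk <-].
have -> : beta = sigma *: (sigma^-1 *: beta) by rewrite scalerA divff ?gt_eqF// scale1r.
rewrite risk_scaled//.
have bk' : (norm0 (sigma^-1 *: beta) <= k)%N by exact: leq_trans (norm0_scale _ _) bk.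
have H := @slope_loss_upper _ _ _ P p k C (unit_weight q p) q c0 e0 e _ (sigma^-1 *: beta) _
  pG k0 Ckp tw (fun i ip => tail_unit_weight q0 q1 ip) c00
  (fun i ip => min_weight_le q0 q1 ip) q0 q1 Cq bk' e00
  (scaled_variational z q0 q1 s0 XX sl (sigma^-1 *: beta)) erefl.
apply: (le_trans (lee_wpmul2l _ H)); first by rewrite lee_fin ltW.
rewrite -EFinM lee_fin -/A2.
have h1 := sum_weight_sqr_ub q0 q1 k0 kp; rewrite -/l -/K1 in h1.
have h2 : \sum_(C * k <= i < p - k) (i.+1%:R * unit_weight q p (k + i)%N ^+ 2)^-1 <= l / M ^+ 2 + K3.
  exact: rank_sum_ub.
set S1 := \sum_(0 <= i < k) _ in h1 *; set S3 := \sum_(_ <= i < _) _ in h2 *.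
rewrite [leRHS](_ : _ = sigma ^+ 2 * (k%:R * ((1 + del) * (2 * l)))); last by ring.
rewrite ler_pM2l//.
have g1 : (1 + e0) * S1 <= k%:R * ((1 + e0) * (2 * l) + 2 * (1 + e0) * `|K1|).
  apply: (@le_trans _ _ ((1 + e0) * (2 * k%:R * (l + K1)))).
    by apply: ler_wpM2l => //; lra.
  rewrite [leLHS](_ : _ = k%:R * ((1 + e0) * (2 * l) + 2 * (1 + e0) * K1)); last by ring.
  rewrite ler_pM2l// lerD2l ler_wpM2l ?ler_norm// mulr_ge0//; lra.
have g3 : A2 * S3 <= k%:R * (del / 4 * l + A2 * K3).
  apply: (@le_trans _ _ (A2 * (l / M ^+ 2 + K3))); first by rewrite ler_pM2l.
  apply: (@le_trans _ _ (del / 4 * l + A2 * K3)).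
    rewrite mulrDr lerD2r mulrCA mulrC ler_wpM2r//.
  rewrite ler_peMl//; apply: addr_ge0; apply: mulr_ge0 => //; last exact: ltW.
  by rewrite divr_ge0// ltW.
have g2 : 2 * (C.+1 * k)%:R / c0 ^+ 2 = k%:R * (2 * C.+1%:R / c0 ^+ 2).
  by rewrite natrM; ring.
rewrite g2.
have g4 : (1 + e0^-1) * (6 * k%:R) = k%:R * (6 * (1 + e0^-1)) by ring.
rewrite g4.
apply: (@le_trans _ _ (k%:R * ((1 + e0) * (2 * l) + del / 4 * l + W))).
  by rewrite /W; move: g1 g3; lra.
rewrite ler_pM2l//.
have dE : del = 4 * e0 by rewrite /e0; field.
have : W <= l * del by lra.
rewrite dE; have : 0 <= l * e0 by rewrite mulr_ge0// ltW.
by lra.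
Qed.

End maximal_risk.

(** * The asymptotic risk *)

Lemma ln_ratio_near (R : realType) (p k : nat -> nat) (B : R) :
  p @ \oo --> \oo -> (forall m, (1 <= k m)%N) ->
  (k m)%:R / (p m)%:R @[m --> \oo] --> (0 : R) ->
  \forall m \near \oo, (0 < p m)%N /\ B <= ln ((p m)%:R / (k m)%:R).
Proof.
move=> p_oo k1 kp.
have pnear : \forall m \near \oo, (0 < p m)%N by exact: (p_oo _ (nbhs_infty_gt 0%N)).
have knear : \forall m \near \oo, `|(k m)%:R / (p m)%:R : R| <= expR (- B).
  by move/cvgr0Pnorm_le : kp; apply; exact: expR_gt0.
near=> m.
have pm : (0 < p m)%N by near: m.
split => //; have km := k1 m.
have pR : 0 < (p m)%:R :> R by rewrite ltr0n.
have kR : 0 < (k m)%:R :> R by rewrite ltr0n.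
have : `|(k m)%:R / (p m)%:R : R| <= expR (- B) by near: m.
rewrite gtr0_norm ?divr_gt0// expRN => H.
rewrite -ler_expR lnK ?posrE ?divr_gt0//.
by rewrite -[leLHS]invrK -invf_div lef_pV2 ?posrE ?divr_gt0 ?invr_gt0 ?expR_gt0.
Unshelve. all: by end_near. Qed.

Theorem theorem1p1 (R : realType) (q sigma : R)
    (q_gt0 : 0 < q) (q_lt1 : q < 1) (sigma_gt0 : 0 < sigma)
    (n p k : nat -> nat)
    (X : forall m : nat, 'M[R]_(n m, p m))
    (orthX : forall m : nat, (X m)^T *m X m = 1%:M)
    (p_oo : p @ \oo --> \oo)
    (k_ge1 : forall m : nat, (1 <= k m)%N)
    (k_p : (k m)%:R / (p m)%:R @[m --> \oo] --> (0 : R))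
    (d : nat -> measure_display)
    (T : forall m : nat, measurableType (d m))
    (P : forall m : nat, probability (T m) R)
    (z : forall m : nat, 'I_(n m) -> {RV (P m) >-> R})
    (gaussz : forall m : nat, gaussian_noise sigma (z m))
    (betahat : forall m : nat, 'cV[R]_(n m) -> 'cV[R]_(p m))
    (slope_betahat : forall m : nat,
       is_slope_estimator (X m) (slope_weight q sigma (p m)) (betahat m)) :
  exists eps : nat -> R,
    (eps m @[m --> \oo] --> (0 : R)) /\
    (\forall m \near \oo,
       ereal_sup [set risk (X m) (z m) (betahat m) beta
                 | beta in [set beta : 'cV[R]_(p m) | (norm0 beta <= k m)%N]]
       = ((1 + eps m) * (2 * sigma ^+ 2 * (k m)%:R
                         * ln ((p m)%:R / (k m)%:R)))%:E).
Proof.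
pose risk_sup m := slope_max_risk (X m) (z m) (betahat m) (k m).
pose L m : R := 2 * sigma ^+ 2 * (k m)%:R * ln ((p m)%:R / (k m)%:R).
have bounds del : 0 < del -> del <= 1 -> \forall m \near \oo, 0 < L m /\
    (((1 - del) * L m)%:E <= risk_sup m <= ((1 + del) * L m)%:E)%E.
  move=> del0 del1.
  have [l0 [l00 H]] := slope_max_risk_bounds q_gt0 q_lt1 sigma_gt0 del0 del1.
  have := ln_ratio_near l0 p_oo k_ge1 k_p; apply: filterS => m [pm lm].
  split; last first.
    by apply/andP; apply: (H _ _ _ _ _ _ (X m) (z m)).
  by rewrite !mulr_gt0 ?exprn_gt0 ?ltr0n ?k_ge1// (lt_le_trans l00).
pose eps m := fine (risk_sup m) / L m - 1.
exists eps; split.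
  apply/cvgr0Pnorm_le => e e0.
  have e1 : 0 < Num.min e 1 by rewrite lt_min e0 ltr01.
  have := bounds _ e1; rewrite ge_min lexx orbT => /(_ isT); apply: filterS => m [L0 /andP[lo hi]].
  have fr : risk_sup m \is a fin_num.
    by rewrite fin_real// (lt_le_trans _ lo) ?ltNyr// (le_lt_trans hi) ?ltry.
  move: lo hi; rewrite -(fineK fr) !lee_fin => lo hi.
  rewrite -ler_pdivlMr// in lo; rewrite -ler_pdivrMr// in hi.
  apply: (@le_trans _ _ (Num.min e 1)); last by rewrite ge_min lexx.
  by rewrite ler_norml /eps; apply/andP; split; lra.
have half0 : 0 < 2^-1 :> R by rewrite invr_gt0.
have half1 : 2^-1 <= 1 :> R by rewrite invf_le1// ler1n.
have := bounds _ half0 half1; apply: filterS => m [L0 /andP[lo hi]].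
have fr : risk_sup m \is a fin_num.
  by rewrite fin_real// (lt_le_trans _ lo) ?ltNyr// (le_lt_trans hi) ?ltry.
rewrite -/(slope_max_risk _ _ _ _) -/(risk_sup m) -(fineK fr) -/(L m); congr EFin.
by rewrite /eps addrCA subrr addr0 divfK// gt_eqF.
Qed.
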